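(* Let $\Phi$ be a Poisson hyperplane process in $\mathbb{R}^d$ with directional distribution $\varphi$ and intensity $\gamma\in(0,\infty)$, and let $X=(X_i)_{i\in\mathbb{N}}$ be an i.i.d. sequence of $[0,\infty)$-valued passage times assigned to the hyperplanes, independent of $\Phi$, with $\mathbb{E}[X_1^{d+\varepsilon}]<\infty$ for some $\varepsilon>0$. Let $\tau=\tau_{L_{\Phi,X}}$ be the induced pseudometric. Then $\tau$ satisfies a weak shape theorem with semi-norm $$\mu(x)=2\,\mathbb{E}[X_1]\,h(x),\qquad x\in\mathbb{R}^d,$$ i.e. a.s. $\lim_{\|x\|_2\to\infty}\frac1{\|x\|_2}(\tau(0,x)-\mu(x))=0$. If moreover $\mathbb{E}[X_1]>0$, then $\tau$ satisfies a shape theorem with limit shape $$S=\{x\in\mathbb{R}^d\mid 2\,\mathbb{E}[X_1]\,h(x)\le1\}.$$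
   Context: For $u\in\mathcal{S}^{d-1}$ (the Euclidean unit sphere) and $r\ge0$ let $E(u,r):=\{x\in\mathbb{R}^d\mid\langle x,u\rangle=r\}$. A Poisson hyperplane process with directional distribution $\varphi$ and intensity $\gamma\in(0,\infty)$ is the random set of hyperplanes $\{E(u,r)\mid(u,r)\in\Phi\}$, identified with $\Phi$, where $\Phi$ is a Poisson process on $\mathcal{S}^{d-1}\times[0,\infty)$ with intensity measure $\gamma\,\varphi\otimes\lambda$, $\lambda$ is Lebesgue measure on $[0,\infty)$, and $\varphi$ is an even probability measure on $\mathcal{S}^{d-1}$ not concentrated on a great subsphere. Write $\Phi=\{E_1,E_2,\dots\}$. For a continuous curve $\gamma:[0,1]\to\mathbb{R}^d$ put $L_{\Phi,X}(\gamma):=\sum_{i\in\mathbb{N}}\mathbf 1\{(\gamma\setminus\gamma(1))\cap E_i\neq\emptyset\}X_i$, where $\gamma\setminus\gamma(1)$ is the curve without its endpoint, and $\tau_{L_{\Phi,X}}(x,y):=\inf_\gamma L_{\Phi,X}(\gamma)$, the infimum over continuous curves from $x$ to $y$. The function $h$ (support function of the associated zonoid) is $$h(x):=\tfrac12\,\mathbb{E}\bigl[|[0,x]\cap\Phi|\bigr]=\frac{\gamma}{4}\int_{\mathcal{S}^{d-1}}|\langle x,u\rangle|\,\varphi(du),$$ where $|[0,x]\cap\Phi|$ is the number of hyperplanes of $\Phi$ hitting the segment $[0,x]$. $\tau$ satisfies a shape theorem with limit shape $S$ if there is a norm $\mu$ on $\mathbb{R}^d$ with $S=\{x\mid\mu(x)\le1\}$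 such that a.s. for every $\varepsilon>0$ and all large enough $n\in\mathbb{N}$, $(1-\varepsilon)S\subset\frac1n\{y\in\mathbb{R}^d\mid\tau(0,y)\le n\}\subset(1+\varepsilon)S$.
   Formalization: In the shape theorem the left inclusion (1-ε)S ⊂ (1/n){τ(0,y) ≤ n} is required only for 0 < ε < 1; read literally for every ε > 0 it fails for ε > 2, where (1-ε)S = (ε-1)S is larger than S. *)

(* Defs.v *)
From mathcomp Require Export all_boot all_order all_algebra finmap.
From mathcomp Require Export all_classical all_reals all_analysis.
From mathcomp Require Export measurable_realfun.

Set Implicit Arguments.
Unset Strict Implicit.
Unset Printing Implicit Defensive.

Import Order.TTheory GRing.Theory Num.Theory.
Import numFieldNormedType.Exports.

Local Open Scope classical_set_scope.
Local Open Scope ring_scope.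

(** * Euclidean space *)

(* The norm carried by ['rV[R]_d] in the library is the sup norm, so the
   Euclidean structure is introduced separately. Both norms induce the same
   topology, which is the one used below for Borel sets and for curves. *)
Definition dot {R : realType} {d : nat} (x y : 'rV[R]_d) : R :=
  \sum_(i < d) x 0 i * y 0 i.

Definition enorm {R : realType} {d : nat} (x : 'rV[R]_d) : R :=
  Num.sqrt (dot x x).

Definition unit_sphere (R : realType) (d : nat) : set 'rV[R]_d :=
  [set u | enorm u = 1].

(* The filter of "‖x‖_2 -> oo". *)
Definition enorm_pinfty (R : realType) (d : nat) : set_system 'rV[R]_d :=
  filter_from [set: R] (fun M => [set x | M < enorm x]).

(* R^d with its Borel sigma-algebra; the carrier is convertible to ['rV_d]. *)
Definition borel_rV (R : realType) (d : nat) :=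
  g_sigma_algebraType (@open 'rV[R]_d).

Definition hyperplane {R : realType} {d : nat} (p : borel_rV R d * R) :
    set 'rV[R]_d :=
  [set x | dot x p.1 = p.2].

Definition segment0 {R : realType} {d : nat} (x : 'rV[R]_d) : set 'rV[R]_d :=
  [set t *: x | t in `[0, 1]].

Definition is_seminorm {R : realType} {d : nat} (mu : 'rV[R]_d -> R) : Prop :=
  [/\ forall x, 0 <= mu x,
      forall (a : R) x, mu (a *: x) = `|a| * mu x &
      forall x y, mu (x + y) <= mu x + mu y].

Definition is_norm {R : realType} {d : nat} (mu : 'rV[R]_d -> R) : Prop :=
  is_seminorm mu /\ forall x, mu x = 0 -> x = 0.

Definition dilate {R : realType} {d : nat} (c : R) (S : set 'rV[R]_d) :
    set 'rV[R]_d :=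
  [set c *: x | x in S].

(** * Independence *)

Section independence.
Context {d0 : measure_display} {Omega : measurableType d0} {R : realType}.
Variable P : probability Omega R.

Definition mutually_independent {d1} {T : measurableType d1} {I : choiceType}
    (X : I -> Omega -> T) : Prop :=
  forall (J : {fset I}) (A : I -> set T),
    (forall i, i \in J -> measurable (A i)) ->
    P (\bigcap_(i in [set` J]) (X i @^-1` A i)) =
    (\prod_(i <- J) P (X i @^-1` A i))%E.

Definition identically_distributed {d1} {T : measurableType d1}
    (X : nat -> {mfun Omega >-> T}) : Prop :=
  forall i (A : set T), measurable A ->
    distribution P (X i) A = distribution P (X 0) A.

(* The sigma-algebra generated by a sequence of random elements. *)
Definition sigma_seq {d1} {T : measurableType d1} (X : nat -> Omega -> T) :
    set_system Omega :=
  <<s \bigcup_i preimage_set_system setT (X i) measurable >>.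

Definition independent_sequences {d1 d2} {T1 : measurableType d1}
    {T2 : measurableType d2} (X : nat -> Omega -> T1) (Y : nat -> Omega -> T2) :
    Prop :=
  forall A B, sigma_seq X A -> sigma_seq Y B -> P (A `&` B) = (P A * P B)%E.

End independence.

(** * Poisson hyperplane processes *)

(* The number of points of the (random) sequence [Y] in [B], with values in
   {0, 1, ..., +oo}. *)
Definition point_count {d0 d1} {Omega : measurableType d0}
    {T : measurableType d1} {R : realType} (Y : nat -> Omega -> T)
    (B : set T) (w : Omega) : \bar R :=
  (\sum_(i <oo) \d_(Y i w) B)%E.

(* The point process [\sum_i \d_(Y i)] is a Poisson process with intensity
   measure [Lambda]. Since [Y] is an infinite sequence, this only makes sense
   for [Lambda] of infinite mass. The second argument of [poisson_prob] is a
   dummy. *)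
Definition is_poisson_process {d0 d1} {Omega : measurableType d0}
    {T : measurableType d1} {R : realType} (P : probability Omega R)
    (Lambda : set T -> \bar R) (Y : nat -> {mfun Omega >-> T}) : Prop :=
  [/\ forall B, measurable B -> (Lambda B < +oo)%E ->
        forall k : nat, P [set w | point_count Y B w = (k%:R : R)%:E] =
          poisson_prob (fine (Lambda B)) 0%N [set k],
      forall B, measurable B -> Lambda B = +oo%E ->
        P [set w | point_count Y B w = (+oo : \bar R)%E] = 1%E &
      forall (n : nat) (B : 'I_n -> set T), (forall i, measurable (B i)) ->
        trivIset setT B ->
        mutually_independent P
          (fun i w => point_count Y (B i) w : \bar R)].

(* A probability measure on the sphere is encoded as a probability measure on
   R^d carried by the sphere. *)
Definition is_directional_distribution {R : realType} {d : nat}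
    (phi : probability (borel_rV R d) R) : Prop :=
  [/\ phi (@unit_sphere R d) = 1%E,
      forall A : set (borel_rV R d), measurable A ->
        phi [set u : 'rV[R]_d | A (- u)] = phi A &
      forall v : 'rV[R]_d, unit_sphere v ->
        (phi [set u : 'rV[R]_d | unit_sphere u /\ dot u v = 0%R] < 1)%E].

(* gamma * (phi \otimes lambda), with lambda the Lebesgue measure on
   [0, +oo). *)
Definition hyperplane_intensity {R : realType} {d : nat}
    (phi : probability (borel_rV R d) R) (gamma : R)
    (B : set (borel_rV R d * R)) : \bar R :=
  (gamma%:E *
   (phi \x (@lebesgue_measure R)) (B `&` (setT `*` `[0%R, +oo[)))%E.

(* The hyperplane E_i is [hyperplane (Y i w)], where [Y i w = (u, r)] lies in
   the product of the sphere and [0, +oo). *)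
Definition is_poisson_hyperplane_process {d0} {Omega : measurableType d0}
    {R : realType} {d : nat} (P : probability Omega R)
    (phi : probability (borel_rV R d) R) (gamma : R)
    (Y : nat -> {mfun Omega >-> (borel_rV R d * R)%type}) : Prop :=
  [/\ is_directional_distribution phi,
      0 < gamma,
      forall i w, unit_sphere ((Y i w).1 : 'rV[R]_d) /\ 0 <= (Y i w).2 &
      is_poisson_process P (hyperplane_intensity phi gamma) Y].

(* |[0, x] \cap Phi| *)
Definition hitting_number {R : realType} {d : nat} (E : nat -> set 'rV[R]_d)
    (x : 'rV[R]_d) : \bar R :=
  (\sum_(i <oo | `[< segment0 x `&` E i !=set0 >]) 1)%E.

Definition zonoid_support {d0} {Omega : measurableType d0}
    {R : realType} {d : nat} (P : probability Omega R)
    (Y : nat -> {mfun Omega >-> (borel_rV R d * R)%type}) (x : 'rV[R]_d) : R :=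
  2^-1 * fine (\int[P]_w hitting_number (fun i => hyperplane (Y i w)) x)%E.

(** * First passage percolation across the hyperplanes *)

Definition curves {R : realType} {d : nat} (x y : 'rV[R]_d) :
    set (R -> 'rV[R]_d) :=
  [set c : R -> 'rV[R]_d |
    [/\ {within `[0, 1], continuous c}, c 0 = x & c 1 = y]].

Definition crossing_length {R : realType} {d : nat}
    (E : nat -> set 'rV[R]_d) (X : nat -> R) (c : R -> 'rV[R]_d) : \bar R :=
  (\sum_(i <oo | `[< ((c @` `[0%R, 1%R]) `\ c 1%R) `&` E i !=set0 >])
     (X i)%:E)%E.

Definition passage_time {R : realType} {d : nat}
    (E : nat -> set 'rV[R]_d) (X : nat -> R) (x y : 'rV[R]_d) : \bar R :=
  ereal_inf [set crossing_length E X c | c in curves x y].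

(** * Shape theorems *)

Definition weak_shape_theorem {d0} {Omega : measurableType d0}
    {R : realType} {d : nat} (P : probability Omega R)
    (tau : Omega -> 'rV[R]_d -> 'rV[R]_d -> \bar R) (mu : 'rV[R]_d -> R) :
    Prop :=
  is_seminorm mu /\
  {ae P, forall w,
    (fun x : 'rV[R]_d => (((enorm x)^-1)%:E * (tau w 0%R x - (mu x)%:E))%E)
      @ (@enorm_pinfty R d) --> (0 : \bar R)%E}.

(* [(1 - eps) S] is only meant for [eps < 1]: for [eps > 1] the dilation factor
   is negative and [(1 - eps) S = (eps - 1) S] by symmetry of [S]. *)
Definition shape_theorem {d0} {Omega : measurableType d0}
    {R : realType} {d : nat} (P : probability Omega R)
    (tau : Omega -> 'rV[R]_d -> 'rV[R]_d -> \bar R) (S : set 'rV[R]_d) : Prop :=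
  exists mu : 'rV[R]_d -> R,
    [/\ is_norm mu, S = [set x | mu x <= 1] &
    {ae P, forall w, forall eps : R, 0 < eps ->
      \forall n \near \oo,
        let B := dilate (n%:R)^-1 [set y | (tau w 0%R y <= n%:R%:E)%E] in
        (eps < 1 -> dilate (1 - eps) S `<=` B) /\
        B `<=` dilate (1 + eps) S}].

(* Main.v *)
Require Import Defs.
From HB Require Import structures.
From mathcomp Require Import ring lra.

(** Only the hyperplanes separating the origin from x matter. A curve from 0
to x <> 0 has to meet every hyperplane with 0 <= r < <x,u> and every
hyperplane through the origin before it reaches x, and the straight segment
meets no other one before x ([passage_timeE]). So tau(0,x) is the sum of the
X_i over the points (u_i, r_i) with r_i = 0 or r_i < <x,u_i>, and the shape
theorem becomes a law of large numbers for a marked Poisson process that has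
to hold uniformly in the direction of x.

For a fixed bounded radial function f >= 0 on the sphere, let W(t) be the sum
of the X_i with r_i <= t f(u_i). The counting variable of this region is
Poisson with mean t gamma (mean of f), so its first two moments are explicit,
and since the marks are i.i.d. and independent of the points, the variance of a
sum of truncated marks is at most twice the second moment of a mark times the
mean number of points ([marked_sum_variance]). Truncating at level t and
taking t = (k+1)^q with q large, a moment of order 1 + e with e > 0 makes the
normalised fluctuations summable in expectation; they vanish almost surely,
and W being nondecreasing, W(t)/t converges along all real t
([marked_sum_slln], [slln_below]). Since d >= 1, the moment hypothesis bounds
such a moment ([passage_moments]).

Uniformity comes from bracketing. A unit vector v is within 1/(m+1) of a point
y of a finite grid in each coordinate, so <v,u> lies between <y,u> - c and
<y,u> + c for all unit u, with c = (d+1)/(m+1). Hence tau(0, s v) lies between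
the two sums W(s) of the radial functions max(0, <y,u> - c) and
max(0, <y,u> + c), whose means differ by at most 4c. Finitely many laws of large
numbers therefore give tau(0,x) = mu(x) + o(|x|) uniformly
([uniform_estimate]), where mu(x) is E[X] gamma times the mean of
max(0, <x,u>), which is 2 E[X] h(x) because a hyperplane meets [0,x] exactly
when r <= max(0, <x,u>) ([expected_hitting_number]).

Evenness of the directional distribution makes mu a seminorm. As the
distribution is not carried by a great subsphere, mu is a norm when E[X] > 0,
and compactness of the sphere bounds it below by a multiple of the Euclidean
norm ([mean_pos_dot_lower]), so that an error o(|x|) is an error o(mu(x)).
Points in a bounded set are handled by the monotonicity of tau(0, .) along
rays ([shape_inclusions]). *)

Set Implicit Arguments.
Unset Strict Implicit.
Unset Printing Implicit Defensive.

Import Order.TTheory GRing.Theory Num.Theory.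
Import numFieldNormedType.Exports.

Local Open Scope classical_set_scope.
Local Open Scope ring_scope.

(** * Expectations of products of independent random elements; Poisson moments *)

Section independent_pairs.
Local Open Scope ereal_scope.
Context {d0 d1 d2 : measure_display} {Omega : measurableType d0}
  {T1 : measurableType d1} {T2 : measurableType d2} {R : realType}.
Variable P : probability Omega R.
Variables (U : {mfun Omega >-> T1}) (V : {mfun Omega >-> T2}).

(** Independence says that the joint law is the product of the marginal laws, so
this is Tonelli's theorem for that product. *)
Lemma ge0_expectation_indep (f : T1 -> \bar R) (g : T2 -> \bar R) :
  (forall A B, measurable A -> measurable B ->
    P (U @^-1` A `&` V @^-1` B) = P (U @^-1` A) * P (V @^-1` B)) ->
  measurable_fun setT f -> measurable_fun setT g ->
  (forall x, 0 <= f x) -> (forall y, 0 <= g y) ->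
  \int[P]_w (f (U w) * g (V w)) = \int[P]_w f (U w) * \int[P]_w g (V w).
Proof.
move=> UV mf mg f0 g0.
pose W : Omega -> T1 * T2 := fun w => (U w, V w).
have mW : measurable_fun setT W by apply: measurable_fun_pair.
pose m1 := distribution P U; pose m2 := distribution P V.
pose h := fun z : T1 * T2 => f z.1 * g z.2.
have mh : measurable_fun setT h.
  by apply: emeasurable_funM; apply: measurableT_comp.
have h0 z : 0 <= h z by apply: mule_ge0.
pose WM : {mfun Omega >-> (T1 * T2)%type} := HB.pack W (isMeasurableFun.Build _ _ _ _ _ mW).
have E1 : \int[P]_w (f (U w) * g (V w)) = \int[distribution P WM]_z h z.
  by rewrite ge0_integral_distribution.
rewrite E1 (eq_measure_integral (m1 \x m2)); last first.
  move=> A mA _; apply/esym; exact: product_measure_unique.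
rewrite fubini_tonelli1//.
transitivity (\int[m1]_x (f x * \int[m2]_y g y)).
  by apply: eq_integral => x _; rewrite /fubini_F /h /= ge0_integralZl.
rewrite ge0_integralZr//; last by apply: integral_ge0.
by rewrite /m1 /m2 !ge0_integral_distribution.
Qed.

End independent_pairs.

Section poisson_moments.
Context {d0 : measure_display} {Omega : measurableType d0} {R : realType}.
Variable P : probability Omega R.

Definition poisson_weight (l : R) (k : nat) : R := l ^+ k / k`!%:R * expR (- l).

(** For [l = 0] both sides are the Dirac mass at 0, because [0 ^+ 0 = 1]. *)
Lemma poisson_prob_set1 (l : R) (k : nat) : 0 <= l ->
  poisson_prob l 0%N [set k] = (poisson_weight l k)%:E.
Proof.
rewrite le_eqVlt => /orP[/eqP<-|l0]; last first.
  by rewrite /poisson_prob l0 esum_set1 /poisson_pmf ?l0// lee_fin mulr_ge0// ?mulr_ge0//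
   ?exprn_ge0 ?ltW.
rewrite /poisson_prob ltxx /poisson_weight diracE oppr0 expR0 mulr1.
case: k => [|k]; first by rewrite mem_set// expr0 fact0 divr1.
by rewrite memNset// expr0n mul0r.
Qed.

Lemma poisson_weight_ge0 (l : R) k : 0 <= l -> 0 <= poisson_weight l k.
Proof. by move=> l0; rewrite /poisson_weight mulr_ge0 ?expR_ge0// divr_ge0 ?exprn_ge0. Qed.

(** The recursion that turns each moment sum into a lower one after a shift of
the index. *)
Lemma poisson_weightS (l : R) k :
  k.+1%:R * poisson_weight l k.+1 = l * poisson_weight l k.
Proof.
rewrite /poisson_weight exprS factS natrM invfM.
have k0 : k.+1%:R != 0 :> R by rewrite pnatr_eq0.
have f0 : k`!%:R != 0 :> R by rewrite pnatr_eq0 -lt0n fact_gt0.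
by field; rewrite f0 addrC natr1 k0.
Qed.

Lemma poisson_weight_sum (l : R) : 0 <= l ->
  (\sum_(k <oo) (poisson_weight l k)%:E = 1)%E.
Proof.
move=> l0; rewrite -(@probability_setT _ _ _ (@poisson_prob R l 0%N)).
have -> : [set: nat] = \bigcup_k [set k] by apply/esym/seteqP; split => // k _; exists k.
rewrite measure_semi_bigcup//; last first.
  by apply/classical_sets.trivIsetP => i j _ _ ij; apply/seteqP; split => // k [/= -> /eqP];
    rewrite (negbTE ij).
by apply: eq_eseriesr => k _; rewrite -poisson_prob_set1.
Qed.

Lemma poisson_weight_mean (l : R) : 0 <= l ->
  (\sum_(k <oo) (k%:R * poisson_weight l k)%:E = l%:E)%E.
Proof.
move=> l0; rewrite nneseries_recl//; last by move=> k _;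
  rewrite lee_fin mulr_ge0// poisson_weight_ge0.
rewrite mul0r add0e -[1%N in X in X = _]add0n.
rewrite -(@nneseries_addn _ (fun k => (k%:R * poisson_weight l k)%:E) 1%N); last first.
  by move=> k; rewrite lee_fin mulr_ge0// poisson_weight_ge0.
under eq_eseriesr => k _ do rewrite addn1 poisson_weightS EFinM.
rewrite nneseriesZl ?poisson_weight_sum ?mule1// => k _.
by rewrite lee_fin poisson_weight_ge0.
Qed.

Lemma poisson_weight_mean2 (l : R) : 0 <= l ->
  (\sum_(k <oo) (k%:R ^+ 2 * poisson_weight l k)%:E = (l ^+ 2 + l)%:E)%E.
Proof.
move=> l0; rewrite nneseries_recl//; last first.
  by move=> k _; rewrite lee_fin mulr_ge0 ?exprn_ge0// poisson_weight_ge0.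
rewrite expr0n mul0r add0e.
rewrite -(@nneseries_addn _ (fun k => (k%:R ^+ 2 * poisson_weight l k)%:E) 1%N); last first.
  by move=> k; rewrite lee_fin mulr_ge0 ?exprn_ge0// poisson_weight_ge0.
have E k : ((k + 1)%:R ^+ 2 * poisson_weight l (k + 1))%:E =
    (l%:E * ((k%:R * poisson_weight l k)%:E + (poisson_weight l k)%:E))%E.
  rewrite addn1 expr2 -mulrA poisson_weightS -EFinD -EFinM -natr1.
  by congr EFin; ring.
under eq_eseriesr => k _ do rewrite E.
have w0 k : (0 <= (poisson_weight l k)%:E)%E by rewrite lee_fin poisson_weight_ge0.
have kw0 k : (0 <= (k%:R * poisson_weight l k)%:E)%E.
  by rewrite lee_fin mulr_ge0 ?poisson_weight_ge0.
rewrite nneseriesZl; last by move=> k _; rewrite adde_ge0.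
rewrite nneseriesD// poisson_weight_mean// poisson_weight_sum// -EFinD -EFinM.
by congr EFin; ring.
Qed.

(** The weights sum to 1, so almost surely [N] is finite and a natural number, and the
  integral splits over its level sets. *)
Lemma ge0_integral_poisson (N : Omega -> \bar R) (l : R) (F : \bar R -> \bar R) :
  0 <= l -> measurable_fun setT N ->
  (forall k : nat, P [set w | N w = (k%:R : R)%:E] = poisson_prob l 0%N [set k]) ->
  measurable_fun setT F -> (forall x, 0 <= F x)%E ->
  (\int[P]_w F (N w) = \sum_(k <oo) F (k%:R)%:E * (poisson_weight l k)%:E)%E.
Proof.
move=> l0 mN PN mF F0.
pose A k := [set w | N w = (k%:R : R)%:E].
have mA k : measurable (A k) by rewrite -[A k]setTI;
  exact: (mN measurableT [set (k%:R)%:E] (emeasurable_set1 _)).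
have tA : trivIset setT A.
  apply/classical_sets.trivIsetP => i j _ _ ij; apply/seteqP; split => // w [] /=;
    rewrite /A /= => -> [] /eqP.
  by rewrite eqr_nat (negbTE ij).
pose D := \bigcup_k A k.
have mD : measurable D by exact: bigcup_measurable.
have PD : P D = 1%E.
  rewrite measure_semi_bigcup// -(poisson_weight_sum l0).
  by apply: eq_eseriesr => k _; rewrite -poisson_prob_set1 -?PN.
rewrite (@ge0_negligible_integral _ _ _ _ _ (~` D))//; last 3 first.
- exact: measurableC.
- exact: measurableT_comp.
- have := probability_setC P mD; rewrite PD subee// => ->.
rewrite setTD setCK ge0_integral_bigcup//; last first.
  by apply: measurable_funTS; exact: measurableT_comp.
apply: eq_eseriesr => k _.
rewrite (eq_integral (cst (F (k%:R)%:E))); last by move=> w; rewrite inE /A /= => ->.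
by rewrite integral_cst// -poisson_prob_set1 -?PN.
Qed.

Lemma poisson_mean (N : Omega -> \bar R) (l : R) :
  0 <= l -> measurable_fun setT N -> (forall w, 0 <= N w)%E ->
  (forall k : nat, P [set w | N w = (k%:R : R)%:E] = poisson_prob l 0%N [set k]) ->
  (\int[P]_w N w = l%:E)%E.
Proof.
move=> l0 mN N0 PN.
rewrite (eq_integral (fun w => `|N w|%E)); last by move=> w _; rewrite gee0_abs.
rewrite (@ge0_integral_poisson _ l (fun x => `|x|%E))//; last exact: measurableT_comp.
rewrite -poisson_weight_mean//; apply: eq_eseriesr => k _.
by rewrite EFinM gee0_abs// lee_fin.
Qed.

Lemma poisson_second_moment (N : Omega -> \bar R) (l : R) :
  0 <= l -> measurable_fun setT N ->
  (forall k : nat, P [set w | N w = (k%:R : R)%:E] = poisson_prob l 0%N [set k]) ->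
  (\int[P]_w (N w * N w) = (l ^+ 2 + l)%:E)%E.
Proof.
move=> l0 mN PN.
rewrite (@ge0_integral_poisson _ l (fun x => x * x)%E)//; last 2 first.
- exact: emeasurable_funM.
- by move=> x; exact: sqre_ge0.
by rewrite -poisson_weight_mean2//; apply: eq_eseriesr => k _; rewrite -!EFinM expr2.
Qed.

End poisson_moments.

(** * First and second moments of marked sums *)

Section sigma_seq.
Context {d0 d1 : measure_display} {Omega : measurableType d0}
  {T : measurableType d1}.

(** Makes events on pairs of terms available to [independent_sequences]. *)
Lemma sigma_seq_pair (X : nat -> Omega -> T) (i j : nat) (C : set (T * T)) :
  measurable C -> sigma_seq X ((fun w => (X i w, X j w)) @^-1` C).
Proof.
move=> mC.
pose G := \bigcup_i preimage_set_system setT (X i) (@measurable _ T).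
pose Om := g_sigma_algebraType G.
have mX k : measurable_fun (setT : set Om) (X k : Om -> T).
  move=> _ A mA; apply: sub_sigma_algebra; exists k => //.
  by exists A.
have mXX : measurable_fun (setT : set Om) ((fun w => (X i w, X j w)) : Om -> (T * T)%type).
  exact: measurable_fun_pair.
have := mXX measurableT _ mC.
by rewrite setTI.
Qed.

End sigma_seq.

Section marked_sum.
Context {d0 d1 : measure_display} {Omega : measurableType d0}
  {T : measurableType d1} {R : realType}.
Variable P : probability Omega R.
Variables (X : nat -> {RV P >-> R}) (Y : nat -> {mfun Omega >-> T}).

(** The mass of [B] under the marked point process that puts mass [g (X i)] at
[Y i]. *)
Definition marked_sum (g : R -> R) (B : set T) (w : Omega) : \bar R :=
  (\sum_(i <oo) (g (X i w) * \1_B (Y i w))%:E)%E.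

Hypothesis X_indep : mutually_independent P X.
Hypothesis X_ident : identically_distributed P X.
Hypothesis X_Y : independent_sequences P X Y.

Variables (B : set T) (l : R) (g : R -> R).
Hypothesis mB : measurable B.
Hypothesis l_ge0 : 0 <= l.
Hypothesis poissonB : forall k : nat,
  P [set w | point_count Y B w = (k%:R : R)%:E] = poisson_prob l 0%N [set k].
Hypothesis mg : measurable_fun setT g.
Hypothesis g_ge0 : forall x, 0 <= g x.

Local Notation mark i := (fun w => g (X i w)).
Local Notation hit i := (fun w => \1_B (Y i w) : R).

Lemma measurable_mark i : measurable_fun setT (mark i).
Proof. exact: measurableT_comp. Qed.

Lemma measurable_hit i : measurable_fun setT (hit i).
Proof. by apply: measurableT_comp => //; exact: measurable_indic. Qed.

Lemma hit_ge0 i w : 0 <= hit i w.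
Proof. by rewrite /= indicE. Qed.

Local Open Scope ereal_scope.

Lemma expectation_mark i : \int[P]_w (mark i w)%:E = \int[P]_w (mark 0 w)%:E.
Proof.
have E k : \int[P]_w (mark k w)%:E = \int[distribution P (X k)]_x (g x)%:E.
  rewrite ge0_integral_distribution//.
  exact/measurable_EFinP.
by rewrite !E; apply: eq_measure_integral => A mA _; exact: X_ident.
Qed.

Lemma expectation_mark_pair i j : i != j ->
  \int[P]_w (mark i w * mark j w)%:E =
  \int[P]_w (mark 0 w)%:E * \int[P]_w (mark 0 w)%:E.
Proof.
move=> ij; under eq_integral do rewrite EFinM.
have mEg : measurable_fun setT (EFin \o g) by exact/measurable_EFinP.
rewrite (@ge0_expectation_indep _ _ _ _ _ _ _ P (X i) (X j) (EFin \o g) (EFin \o g))//=.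
- by rewrite (expectation_mark i) (expectation_mark j).
- move=> A1 A2 mA1 mA2.
  have /= := @X_indep [fset i; j]%fset (fun k => if k == i then A1 else A2).
  rewrite big_fsetU1/= ?big_seq_fset1 ?inE// eqxx [j == i]eq_sym (negbTE ij).
  move=> <-; last by move=> k _; case: ifP.
  congr (P _); apply/seteqP; split => w /=.
    move=> [w1 w2] k /=; rewrite !inE => /orP[|] /eqP ->; first by rewrite eqxx.
    by rewrite [j == i]eq_sym (negbTE ij).
  move=> h; split; first by have /= := h i; rewrite !inE !eqxx; apply.
  by have /= := h j; rewrite !inE eqxx orbT [j == i]eq_sym (negbTE ij); apply.
Qed.

Lemma expectation_mark_hit_pair i j :
  \int[P]_w (mark i w * hit i w * (mark j w * hit j w))%:E =
  \int[P]_w (mark i w * mark j w)%:E * \int[P]_w (hit i w * hit j w)%:E.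
Proof.
pose U : Omega -> R * R := fun w => (X i w, X j w).
pose V : Omega -> T * T := fun w => (Y i w, Y j w).
have mU : measurable_fun setT U by exact: measurable_fun_pair.
have mV : measurable_fun setT V by exact: measurable_fun_pair.
pose UM : {mfun Omega >-> (R * R)%type} := HB.pack U (isMeasurableFun.Build _ _ _ _ _ mU).
pose VM : {mfun Omega >-> (T * T)%type} := HB.pack V (isMeasurableFun.Build _ _ _ _ _ mV).
pose f := fun z : R * R => (g z.1 * g z.2)%:E.
pose h := fun z : T * T => (\1_B z.1 * \1_B z.2 : R)%:E.
rewrite -(@ge0_expectation_indep _ _ _ _ _ _ _ P UM VM f h).
- apply: eq_integral => w _; rewrite /f /h /= -EFinM; congr EFin; ring.
- by move=> A C mA mC; apply: X_Y; exact: sigma_seq_pair.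
- apply/measurable_EFinP; apply: measurable_funM; apply: measurableT_comp => //.
- apply/measurable_EFinP; apply: measurable_funM; apply: measurableT_comp => //;
    exact: measurable_indic.
- by move=> z; rewrite lee_fin mulr_ge0.
- by move=> z; rewrite lee_fin mulr_ge0// indicE.
Qed.

Lemma expectation_mark_hit i :
  \int[P]_w (mark i w * hit i w)%:E = \int[P]_w (mark 0 w)%:E * \int[P]_w (hit i w)%:E.
Proof.
under eq_integral do rewrite EFinM.
rewrite (@ge0_expectation_indep _ _ _ _ _ _ _ P (X i) (Y i) (EFin \o g) (fun y => (\1_B y :
  R)%:E))//=.
- by rewrite (expectation_mark i).
- move=> A C mA mC; apply: X_Y; apply: sub_sigma_algebra; exists i => //.
    by exists A => //; rewrite setTI.
  by exists C => //; rewrite setTI.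
- exact/measurable_EFinP.
- by apply/measurable_EFinP; exact: measurable_indic.
Qed.

Lemma point_countE w : point_count Y B w = \sum_(i <oo) (hit i w)%:E.
Proof. by apply: eq_eseriesr => i _; rewrite diracE indicE. Qed.

Lemma measurable_point_count : measurable_fun setT (point_count Y B : Omega -> \bar R).
Proof.
rewrite (_ : point_count Y B = fun w => \sum_(i <oo) (hit i w)%:E); last first.
  by apply/funext => w; exact: point_countE.
apply: (@ge0_emeasurable_sum _ _ _ _ _ xpredT) => [k w _ _|k _].
  by rewrite lee_fin hit_ge0.
by apply/measurable_EFinP; exact: measurable_hit.
Qed.

Lemma point_count_ge0 w : 0 <= (point_count Y B w : \bar R).
Proof. by rewrite point_countE; apply: nneseries_ge0 => i _ _; rewrite lee_fin hit_ge0. Qed.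

Lemma marked_sum_ge0 w : 0 <= marked_sum g B w.
Proof. by apply: nneseries_ge0 => i _ _; rewrite lee_fin mulr_ge0// hit_ge0. Qed.

Lemma measurable_term i : measurable_fun setT (fun w => (mark i w * hit i w)%:E).
Proof.
by apply/measurable_EFinP; apply: measurable_funM; [exact: measurable_mark|exact: measurable_hit].
Qed.

Lemma measurable_marked_sum : measurable_fun setT (marked_sum g B).
Proof.
apply: (@ge0_emeasurable_sum _ _ _ _ _ xpredT) => [k w _ _|k _].
  by rewrite lee_fin mulr_ge0// hit_ge0.
exact: measurable_term.
Qed.

Lemma sum_expectation_hit : \sum_(i <oo) \int[P]_w (hit i w)%:E = l%:E.
Proof.
rewrite -integral_nneseries//; last first.
  by move=> i; apply/measurable_EFinP; exact: measurable_hit.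
rewrite -(poisson_mean l_ge0 measurable_point_count point_count_ge0 poissonB).
by apply: eq_integral => w _; rewrite point_countE.
Qed.

Lemma expectation_marked_sum (m : R) : \int[P]_w (mark 0 w)%:E = m%:E ->
  \int[P]_w marked_sum g B w = (m * l)%:E.
Proof.
move=> Em; rewrite integral_nneseries//; last 2 first.
- exact: measurable_term.
- by move=> i w _; rewrite lee_fin mulr_ge0// hit_ge0.
under eq_eseriesr => i _ do rewrite expectation_mark_hit Em.
rewrite nneseriesZl ?sum_expectation_hit// => i _.
by apply: integral_ge0 => w _; rewrite lee_fin hit_ge0.
Qed.

Lemma sqr_sum_EFin (a : nat -> R) n :
  (\sum_(i < n) (a i)%:E) * (\sum_(i < n) (a i)%:E) =
  \sum_(i < n) \sum_(j < n) (a i * a j)%:E.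
Proof.
rewrite sumEFin -EFinM big_distrlr/= -sumEFin.
by apply: eq_bigr => i _; rewrite sumEFin.
Qed.

(** Expanding the square, an off-diagonal term factors as [m ^+ 2] times the
probability that both points lie in [B], and a diagonal term as [s] times the
probability that one does. Bounding the diagonal by both contributions leaves
[m ^+ 2] times the second moment of the number of points in [B] plus [s] times
its mean. *)
Lemma partial_second_moment n (m s : R) :
  \int[P]_w (mark 0 w)%:E = m%:E ->
  \int[P]_w (mark 0 w ^+ 2)%:E = s%:E ->
  \int[P]_w ((\sum_(i < n) (mark i w * hit i w)%:E) *
    (\sum_(i < n) (mark i w * hit i w)%:E)) <=
  (m ^+ 2 * (l ^+ 2 + l) + s * l)%:E.
Proof.
move=> Em Es.
have mm i j : measurable_fun setT (fun w => (mark i w * hit i w * (mark j w * hit j w))%:E).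
  under eq_fun do rewrite EFinM.
  by apply: emeasurable_funM; exact: measurable_term.
have mh i j : measurable_fun setT (fun w => (hit i w * hit j w)%:E).
  by apply/measurable_EFinP; apply: measurable_funM; exact: measurable_hit.
have m0 i j w : 0 <= (mark i w * hit i w * (mark j w * hit j w))%:E.
  by rewrite lee_fin !mulr_ge0// hit_ge0.
have h0 i j w : 0 <= (hit i w * hit j w)%:E by rewrite lee_fin mulr_ge0// hit_ge0.
under eq_integral do rewrite (sqr_sum_EFin (fun i => mark i _ * hit i _)%R).
have E2 (F : nat -> nat -> Omega -> \bar R) :
    (forall i j, measurable_fun setT (F i j)) -> (forall i j w, 0 <= F i j w) ->
    \int[P]_w (\sum_(i < n) \sum_(j < n) F i j w) =
    \sum_(i < n) \sum_(j < n) \int[P]_w F i j w.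
  move=> mF F0; rewrite ge0_integral_sum//; last 2 first.
  - by move=> i; apply: emeasurable_sum.
  - by move=> i w _; apply: sume_ge0.
  by apply: eq_bigr => i _; rewrite ge0_integral_sum.
rewrite (E2 (fun i j w => (mark i w * hit i w * (mark j w * hit j w))%:E))//.
have s0 : (0 <= s)%R.
  by rewrite -lee_fin -Es; apply: integral_ge0 => w _; rewrite lee_fin sqr_ge0.
have hit2 i w : (hit i w * hit i w = hit i w)%R.
  by rewrite -expr2 indicE; case: (_ \in _); rewrite ?expr1n ?expr0n.
have bound i j : \int[P]_w (mark i w * hit i w * (mark j w * hit j w))%:E <=
    (m ^+ 2)%:E * \int[P]_w (hit i w * hit j w)%:E +
    (if i == j then s%:E * \int[P]_w (hit i w)%:E else 0).
  have hh0 : 0 <= \int[P]_w (hit i w * hit j w)%:E by apply: integral_ge0.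
  rewrite expectation_mark_hit_pair; case: eqVneq => [<-|ij]; last first.
    by rewrite expectation_mark_pair// Em adde0 -EFinM -expr2.
  under [in X in _ * X <= _]eq_integral do rewrite hit2.
  have -> : \int[P]_w (mark i w * mark i w)%:E = s%:E.
    rewrite -Es.
    have E k : \int[P]_w (mark k w ^+ 2)%:E = \int[distribution P (X k)]_x (g x ^+ 2)%:E.
      rewrite ge0_integral_distribution//.
      by apply/measurable_EFinP; exact: measurable_funX.
      by move=> x; rewrite lee_fin sqr_ge0.
    under eq_integral do rewrite -expr2.
    by rewrite !E; apply: eq_measure_integral => A mA _; exact: X_ident.
  by rewrite leeDr// mule_ge0// ?lee_fin ?sqr_ge0//; exact: integral_ge0.
apply: (@le_trans _ _ (\sum_(i < n) \sum_(j < n)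
  ((m ^+ 2)%:E * \int[P]_w (hit i w * hit j w)%:E +
    (if i == j then s%:E * \int[P]_w (hit i w)%:E else 0)))).
  by apply: lee_sum => i _; apply: lee_sum => j _; exact: bound.
under eq_bigr do rewrite big_split/=.
rewrite big_split/= EFinD; apply: leeD.
  rewrite (_ : \sum_(i < n) _ = (m ^+ 2)%:E *
      \sum_(i < n) \sum_(j < n) \int[P]_w (hit i w * hit j w)%:E); last first.
    rewrite ge0_sume_distrr; last by move=> i _; apply: sume_ge0 => j _; exact: integral_ge0.
    apply: eq_bigr => i _; rewrite ge0_sume_distrr// => j _; exact: integral_ge0.
  rewrite [X in _ <= X]EFinM; apply: lee_wpmul2l; first by rewrite lee_fin sqr_ge0.
  rewrite -(poisson_second_moment l_ge0 measurable_point_count poissonB).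
  rewrite -(E2 (fun i j w => (hit i w * hit j w)%:E))//.
  apply: ge0_le_integral => //.
  - by move=> w _; apply: sume_ge0 => i _; apply: sume_ge0.
  - by apply: emeasurable_sum => i; apply: emeasurable_sum => j.
  - by apply: emeasurable_funM; exact: measurable_point_count.
  move=> w _; rewrite -(sqr_sum_EFin (fun i => hit i w)).
  have Nn : \sum_(i < n) (hit i w)%:E <= point_count Y B w.
    rewrite point_countE -(big_mkord xpredT (fun i => (hit i w)%:E)).
    by apply: nneseries_lim_ge => i _ _; rewrite lee_fin hit_ge0.
  by apply: lee_pmul => //; apply: sume_ge0 => i _; rewrite lee_fin hit_ge0.
rewrite (eq_bigr (fun i : 'I_n => s%:E * \int[P]_w (hit i w)%:E)); last first.
  move=> i _; rewrite (bigD1 i)//= eqxx big1 ?adde0// => j ji.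
  by rewrite eq_sym (negbTE ji).
rewrite -ge0_sume_distrr; last by move=> i _; exact: integral_ge0.
rewrite [X in _ <= X]EFinM; apply: lee_wpmul2l; first by rewrite lee_fin.
rewrite -sum_expectation_hit -(big_mkord xpredT (fun i => \int[P]_w (hit i w)%:E)).
by apply: nneseries_lim_ge => i _ _; exact: integral_ge0.
Qed.

Lemma marked_sum_second_moment (m s : R) :
  \int[P]_w (mark 0 w)%:E = m%:E ->
  \int[P]_w (mark 0 w ^+ 2)%:E = s%:E ->
  \int[P]_w (marked_sum g B w * marked_sum g B w) <=
  (m ^+ 2 * (l ^+ 2 + l) + s * l)%:E.
Proof.
move=> Em Es.
pose S n w := \sum_(i < n) (mark i w * hit i w)%:E.
have S0 n w : 0 <= S n w by apply: sume_ge0 => i _; rewrite lee_fin mulr_ge0// hit_ge0.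
have mS n : measurable_fun setT (S n) by apply: emeasurable_sum => i; exact: measurable_term.
have ndS w : {homo S ^~ w : a b / (a <= b)%N >-> a <= b}.
  move=> a b ab; rewrite /S -!(big_mkord xpredT (fun i => (mark i w * hit i w)%:E)).
  by apply: lee_sum_nneg_natr => // i _ _; rewrite lee_fin mulr_ge0// hit_ge0.
have cvgS w : S ^~ w @ \oo --> marked_sum g B w.
  rewrite /S; under eq_fun do rewrite -(big_mkord xpredT (fun i => (mark i w * hit i w)%:E)).
  by apply: is_cvg_nneseries => i _ _; rewrite lee_fin mulr_ge0// hit_ge0.
have cvgSS w : (S n w * S n w) @[n --> \oo] --> marked_sum g B w * marked_sum g B w.
  apply: cvgeM => //; rewrite mule_defE negb_or; case: (marked_sum g B w) => [r||] //=;
    rewrite ?andbF //.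
have -> : \int[P]_w (marked_sum g B w * marked_sum g B w) =
    \int[P]_w (limn (fun n => S n w * S n w)).
  by apply: eq_integral => w _; apply/esym/cvg_lim.
have cvgI : \int[P]_w (S n w * S n w) @[n --> \oo] -->
    \int[P]_w (limn (fun n => S n w * S n w)).
  apply: (@cvg_monotone_convergence _ _ _ P setT measurableT (fun n w => S n w * S n w)).
  - by move=> n; exact: emeasurable_funM.
  - by move=> n w _; rewrite mule_ge0.
  - by move=> w _ a b ab; rewrite lee_pmul// ndS.
rewrite -(cvg_lim _ cvgI)//; apply: lime_le; first by apply/cvg_ex; eexists; exact: cvgI.
by apply: nearW => n; exact: partial_second_moment.
Qed.

(** With [m * l] the mean of the marked sum, the square of this mean cancels in
the bound of the second moment and leaves [m ^+ 2 * l + s * l],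
which is at most [2 * s * l]. *)
Lemma marked_sum_variance (m s : R) :
  \int[P]_w (mark 0 w)%:E = m%:E ->
  \int[P]_w (mark 0 w ^+ 2)%:E = s%:E -> (m ^+ 2 <= s)%R ->
  \int[P]_w ((marked_sum g B w - (m * l)%:E) * (marked_sum g B w - (m * l)%:E)) <=
  (2 * s * l)%:E.
Proof.
move=> Em Es ms.
have m0 : (0 <= m)%R.
  by rewrite -lee_fin -Em; apply: integral_ge0 => w _; rewrite lee_fin.
pose S := marked_sum g B; pose a := (m * l)%R.
have a0 : (0 <= a)%R by rewrite mulr_ge0.
have mS : measurable_fun setT S := measurable_marked_sum.
have mSa : measurable_fun setT (fun w => (S w - a%:E) * (S w - a%:E)).
  by apply: emeasurable_funM; apply: emeasurable_funB.
(* The cross term is moved to the other side, so that only nonnegative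
   functions are integrated, [S] being possibly infinite. *)
have E : \int[P]_w ((S w - a%:E) * (S w - a%:E)) + (2 * a)%:E * \int[P]_w S w =
    \int[P]_w (S w * S w) + (a ^+ 2)%:E.
  rewrite -ge0_integralZl//; last 2 first.
  - by move=> w _; exact: marked_sum_ge0.
  - by rewrite lee_fin mulr_ge0.
  rewrite -ge0_integralD//; last 3 first.
  - by move=> w _; exact: sqre_ge0.
  - by move=> w _; rewrite mule_ge0 ?marked_sum_ge0// lee_fin mulr_ge0.
  - exact: emeasurable_funM.
  transitivity (\int[P]_w (S w * S w + (a ^+ 2)%:E)).
    apply: eq_integral => w _; have := marked_sum_ge0 w; rewrite -/(S w).
    case: (S w) => [r _|_|//].
      by rewrite -EFinB -!EFinM -!EFinD; congr EFin; ring.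
    have -> : +oo - a%:E = +oo by [].
    rewrite mulyy (_ : +oo + (a ^+ 2)%:E = +oo)// addye//.
    have : 0 <= (2 * a)%:E * (+oo : \bar R) by rewrite mule_ge0// lee_fin mulr_ge0.
    by case: (_ * _).
  rewrite ge0_integralD//.
  - rewrite integral_cst//; congr (_ + _).
    transitivity ((a ^+ 2)%:E * 1); last by rewrite mule1.
    by congr (_ * _); exact: probability_setT.
  - by move=> w _; exact: sqre_ge0.
  - exact: emeasurable_funM.
  - by move=> w _; rewrite lee_fin sqr_ge0.
have := marked_sum_second_moment Em Es.
move: E; rewrite (expectation_marked_sum Em) -/S -/a.
have : 0 <= \int[P]_w ((S w - a%:E) * (S w - a%:E)) by apply: integral_ge0 => w _; exact: sqre_ge0.
have : 0 <= \int[P]_w (S w * S w) by apply: integral_ge0 => w _; exact: sqre_ge0.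
case: (\int[P]_w (S w * S w)) => // q _.
case: (\int[P]_w _) => // r _; rewrite -EFinM -!EFinD => -[E].
rewrite !lee_fin => h.
have -> : r = (q + a ^+ 2 - 2 * a * a)%R by rewrite -E; ring.
apply: (@le_trans _ _ (m ^+ 2 * (l ^+ 2 + l) + s * l + a ^+ 2 - 2 * a * a)%R).
  by rewrite !lerD2r.
have -> : (m ^+ 2 * (l ^+ 2 + l) + s * l + a ^+ 2 - 2 * a * a = m ^+ 2 * l + s * l)%R.
  by rewrite /a; ring.
have : (m ^+ 2 * l <= s * l)%R by rewrite ler_wpM2r.
by move=> ?; lra.
Qed.

End marked_sum.

(** * Interpolation between polynomial times, and truncation *)

Section interpolation.
Context {R : realType}.

Lemma poly_time_bracket (q : nat) (t : R) : (0 < q)%N -> 1 <= t ->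
  exists k : nat, k.+1%:R ^+ q <= t < k.+2%:R ^+ q.
Proof.
move=> q0 t1; pose p k := (k.+1%:R ^+ q <= t).
have ex_p : exists k, p k by exists 0%N; rewrite /p expr1n.
have ub_p k : p k -> (k <= Num.truncn t)%N.
  rewrite /p => kt; rewrite truncn_ge_nat; last by lra.
  apply: le_trans kt; rewrite -natrX ler_nat (leq_trans (leqnSn k))//.
  by rewrite -[X in (X <= _)%N]expn1 leq_pexp2l.
case: (ex_maxnP ex_p ub_p) => k pk maxk; exists k.
by rewrite [X in X && _]pk ltNge; apply/negP => /maxk; rewrite ltnn.
Qed.

Lemma poly_time_ratio (q : nat) (e : R) : 0 < e ->
  \forall k \near \oo, k.+2%:R ^+ q <= (1 + e) * k.+1%:R ^+ q.
Proof.
move=> e0.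
have cvg1 : (1 + (harmonic k : R)) ^+ q @[k --> \oo] --> (1 : R).
  have c1 : 1 + (harmonic k : R) @[k --> \oo] --> (1 : R).
    rewrite -[X in _ --> X]addr0; apply: cvgD; first exact: cvg_cst.
    exact: cvg_harmonic.
  rewrite -[X in _ --> X](expr1n _ q);
    exact: (@continuous_cvg _ _ _ _ _ _ (fun x : R => x ^+ q) _ (@exprn_continuous R q 1) c1).
have e1 : (1 : R) < 1 + e by lra.
near=> k.
have k0 : k.+1%:R != 0 :> R by rewrite pnatr_eq0.
have -> : k.+2%:R = (1 + harmonic k) * k.+1%:R :> R.
  by rewrite /harmonic/= mulrDl mulVf// mul1r -natr1 addrC.
rewrite exprMn ler_wpM2r ?exprn_ge0// ltW//.
by near: k; exact: (cvgr_lt _ cvg1).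
Unshelve. all: by end_near. Qed.

(** Consecutive times [k.+1 ^+ q] have ratio tending to 1, so a nondecreasing
function that is asymptotically linear along them is so along all reals. *)
Lemma poly_time_interpolation (F : R -> \bar R) (A : R) (q : nat) :
  (0 < q)%N -> 0 <= A ->
  (forall s t, 0 < s -> s <= t -> (F s <= F t)%E) ->
  (forall e : R, 0 < e -> \forall k \near \oo,
     (((A - e) * k.+1%:R ^+ q)%:E <= F (k.+1%:R ^+ q)%R <= ((A + e) * k.+1%:R ^+ q)%:E)%E) ->
  forall e : R, 0 < e -> \forall t \near +oo,
    (((A - e) * t)%:E <= F t <= ((A + e) * t)%:E)%E.
Proof.
move=> q0 A0 ndF Fk e e0.
pose eta := Num.min 1 (e / (A + 2)).
have A2 : 0 < A + 2 by lra.
have eta0 : 0 < eta by rewrite lt_min ltr01 divr_gt0.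
have eta1 : eta <= 1 by rewrite ge_min lexx.
have etaA : eta * (A + 2) <= e by rewrite -ler_pdivlMr// ge_min lexx orbT.
have [K _ HK] : \forall k \near \oo, k.+2%:R ^+ q <= (1 + eta) * k.+1%:R ^+ q /\
   forall j, (k <= j)%N ->
   (((A - eta) * j.+1%:R ^+ q)%:E <= F (j.+1%:R ^+ q)%R <= ((A + eta) * j.+1%:R ^+ q)%:E)%E.
  have [K _ HK] := Fk _ eta0.
  near=> k; split; first by near: k; exact: poly_time_ratio.
  by move=> j kj; apply: HK => /=; apply: leq_trans kj; near: k; exists K.
exists (K.+1%:R ^+ q); split; first exact: num_real.
move=> t Kt.
have KT : 0 < K.+1%:R ^+ q :> R by rewrite exprn_gt0.
have t1 : 1 <= t.
  by apply: le_trans (ltW Kt); rewrite -natrX ler1n expn_gt0.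
have [k /andP[kt tk]] := poly_time_bracket q0 t1.
have Kk : (K <= k)%N.
  rewrite leqNgt; apply/negP => kK.
  have := lt_trans Kt tk; apply/negP; rewrite -leNgt.
  by rewrite lerXn2r ?nnegrE// ler_nat.
have [ratio Hk] := HK k Kk.
set s := k.+1%:R ^+ q in ratio kt Hk; set s' := k.+2%:R ^+ q in ratio tk.
have s0 : 0 < s by rewrite exprn_gt0.
have /andP[lo _] := Hk _ (leqnn k).
have /andP[_ up] := Hk _ (leqnSn k).
have t0 : 0 < t by lra.
apply/andP; split.
  apply: (@le_trans _ _ (F s)); last exact: ndF.
  apply: le_trans lo; rewrite lee_fin.
  have h1 : t <= (1 + eta) * s by lra.
  have h2 : (1 - eta) * t <= s.
    apply: (@le_trans _ _ ((1 - eta) * ((1 + eta) * s))); first by rewrite ler_wpM2l//; lra.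
    rewrite mulrA ler_piMl//; nra.
  have h3 : A * ((1 - eta) * t) <= A * s by rewrite ler_wpM2l.
  have h4 : eta * s <= eta * t by rewrite ler_wpM2l// ltW.
  have h5 : eta * (A + 2) * t <= e * t by rewrite ler_wpM2r// ltW.
  have h6 : 0 <= eta * t by rewrite mulr_ge0// ltW.
  by rewrite -/s; clearbody s s'; nra.
apply: (@le_trans _ _ (F s')); first by apply: ndF => //; exact: ltW.
apply: le_trans up _; rewrite lee_fin.
have h1 : (A + eta) * s' <= (A + eta) * ((1 + eta) * t).
  rewrite ler_wpM2l//; first by lra.
  by apply: le_trans ratio _; rewrite ler_wpM2l//; lra.
apply: le_trans h1 _; rewrite mulrA ler_wpM2r//; first exact: ltW.
have : eta * eta <= eta by rewrite ler_piMl// ltW.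
by move=> ?; nra.
Unshelve. all: by end_near. Qed.

End interpolation.

Section inverse_squares.
Context {R : realType}.
Local Open Scope ereal_scope.

Lemma sum_inverse_squares_lty (C : R) : (0 <= C)%R ->
  \sum_(k <oo) (C / k.+1%:R ^+ 2)%:E < +oo.
Proof.
move=> C0; apply: (@le_lt_trans _ _ (2 * C)%:E); last exact: ltry.
have u0 k : 0 <= (C / k.+1%:R ^+ 2)%:E :> \bar R by rewrite lee_fin divr_ge0.
apply: lime_le; first by apply: is_cvg_nneseries.
apply: nearW => n; rewrite sumEFin lee_fin.
have H m : (\sum_(0 <= k < m.+1) C / k.+1%:R ^+ 2 <= C * (2 - m.+1%:R^-1) :> R)%R.
  elim: m => [|m IH]; first by rewrite big_nat1 expr1n invr1 mulr1; lra.
  rewrite big_nat_recr//=; apply: (le_trans (lerD IH (lexx _))).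
  rewrite -mulrDr ler_wpM2l//.
  have m1 : (0 < m.+1%:R :> R)%R by rewrite ltr0n.
  have m2 : (0 < m.+2%:R :> R)%R by rewrite ltr0n.
  have m3 : (m.+2%:R = m.+1%:R + 1 :> R)%R by rewrite natr1.
  suff : ((m.+2%:R ^+ 2)^-1 <= m.+1%:R^-1 - m.+2%:R^-1 :> R)%R.
    move: (m.+1%:R^-1)%R (m.+2%:R^-1)%R ((m.+2%:R ^+ 2)^-1)%R => a b c.
    by move=> ?; lra.
  have frac (x : R) : (0 < x -> x^-1 - (x + 1)^-1 = (x * (x + 1))^-1)%R.
    by move=> x0; field; rewrite !gt_eqF//; lra.
  rewrite m3 frac// -m3.
  rewrite lef_pV2 ?posrE ?exprn_gt0 ?mulr_gt0// expr2 ler_wpM2r ?ltW//.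
  by rewrite m3; lra.
case: n => [|n]; first by rewrite big_geq// mulr_ge0.
apply: (le_trans (H n)); rewrite mulrC ler_wpM2r//.
by rewrite lerBlDr lerDl invr_ge0.
Qed.

End inverse_squares.

Section truncation.
Context {R : realType}.
Implicit Types x t e : R.

Definition trunc_below t x : R := if `|x| <= t then `|x| else 0.
Definition trunc_above t x : R := if `|x| <= t then 0 else `|x|.

Lemma trunc_below_ge0 t x : 0 <= trunc_below t x.
Proof. by rewrite /trunc_below; case: ifP. Qed.

Lemma trunc_above_ge0 t x : 0 <= trunc_above t x.
Proof. by rewrite /trunc_above; case: ifP. Qed.

Lemma trunc_split t x : trunc_below t x + trunc_above t x = `|x|.
Proof. by rewrite /trunc_below /trunc_above; case: ifP; rewrite ?addr0 ?add0r. Qed.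

Lemma measurable_trunc_below t : measurable_fun setT (trunc_below t).
Proof.
apply: measurable_fun_ifT => //.
by apply: measurable_fun_ler => //; exact: normr_measurable.
Qed.

Lemma measurable_trunc_above t : measurable_fun setT (trunc_above t).
Proof.
apply: measurable_fun_ifT => //.
by apply: measurable_fun_ler => //; exact: normr_measurable.
Qed.

(** For [`|x| <= t] one trades the power [1 - e] of [`|x|] for the same power of
[t]; this needs [e <= 1]. *)
Lemma trunc_below_sqr_le t x e : 0 < t -> 0 < e <= 1 ->
  trunc_below t x ^+ 2 <= t / t `^ e * `|x| `^ (1 + e).
Proof.
move=> t0 /andP[e0 e1]; rewrite /trunc_below; case: ifPn => [xt|_]; last first.
  by rewrite expr0n/= mulr_ge0 ?powR_ge0// divr_ge0 ?powR_ge0// ltW.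
have [->|x0] := eqVneq x 0.
  by rewrite normr0 expr0n/= mulr_ge0 ?powR_ge0// divr_ge0 ?powR_ge0// ltW.
have nx : 0 < `|x| by rewrite normr_gt0.
rewrite powRD; last by rewrite (gt_eqF nx) implybT.
rewrite powRr1// expr2 mulrCA ler_pM2l//.
have te : 0 < t `^ e by exact: powR_gt0.
have split_e (y : R) : 0 < y -> y = y `^ (1 - e) * y `^ e.
  by move=> y0; rewrite -powRD ?subrK ?powRr1 ?ltW// (gt_eqF y0) implybT.
rewrite mulrAC ler_pdivlMr// [X in X * _](split_e _ nx) [X in _ <= X * _](split_e _ t0).
rewrite -mulrA -[leRHS]mulrA [t `^ e * _]mulrC; apply: ler_wpM2r.
  by rewrite mulr_ge0 ?powR_ge0.
by rewrite ge0_ler_powR ?nnegrE// ?subr_ge0// ?ltW.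
Qed.

Lemma trunc_above_le t x e : 0 < t -> 0 < e ->
  trunc_above t x <= `|x| `^ (1 + e) / t `^ e.
Proof.
move=> t0 e0; have te : 0 < t `^ e by exact: powR_gt0.
rewrite /trunc_above; case: ifPn => [_|]; first by rewrite divr_ge0 ?powR_ge0.
rewrite -ltNge => tx; have nx : 0 < `|x| by exact: lt_trans tx.
rewrite powRD; last by rewrite (gt_eqF nx) implybT.
rewrite powRr1// ler_pdivlMr// ler_pM2l// ge0_ler_powR ?nnegrE// ?ltW//.
Qed.

End truncation.

(** * Strong law of large numbers for marked sums *)

Lemma double_mul_le_sqr (R : realFieldType) (x y : R) :
  2 * y * x <= x ^+ 2 + y ^+ 2.
Proof. by have := sqr_ge0 (x - y); nra. Qed.

(** Meant for a truncated mean [b], a mean number of points [t * c] and a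
relative fluctuation [eta]: the two errors are absorbed in [delta]. *)
Lemma lower_estimate (R : realFieldType) (m b c t eta delta : R) :
  (m - b) * (t * c) <= eta * (t * c) -> eta * (c + 2) * t <= delta * t ->
  0 <= eta * t -> (m * c - delta) * t <= b * (t * c) - eta * t.
Proof. by move=> h1 h2 h3; lra. Qed.

Lemma upper_estimate (R : realFieldType) (m b c t eta delta : R) :
  0 <= (m - b) * (t * c) -> eta * (c + 2) * t <= delta * t ->
  0 <= eta * c * t -> b * (t * c) + 2 * eta * t <= (m * c + delta) * t.
Proof. by move=> h1 h2 h3; lra. Qed.

Section marked_sum_slln.
Context {d0 d1 : measure_display} {Omega : measurableType d0}
  {T : measurableType d1} {R : realType}.
Variable P : probability Omega R.
Variables (X : nat -> {RV P >-> R}) (Y : nat -> {mfun Omega >-> T}).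
Hypothesis X_indep : mutually_independent P X.
Hypothesis X_ident : identically_distributed P X.
Hypothesis X_Y : independent_sequences P X Y.

Variables (B : R -> set T) (c : R).
Hypothesis mB : forall t, 0 < t -> measurable (B t).
Hypothesis ndB : forall s t, 0 < s -> s <= t -> B s `<=` B t.
Hypothesis c_ge0 : 0 <= c.
Hypothesis poissonB : forall t, 0 < t -> forall k : nat,
  P [set w | point_count Y (B t) w = (k%:R : R)%:E] =
  poisson_prob (t * c) 0%N [set k].

Variables (e C m : R).
Hypothesis e01 : 0 < e <= 1.
Hypothesis Em : (\int[P]_w (`|X 0%N w|)%:E = m%:E)%E.
Hypothesis EC : (\int[P]_w (`|X 0%N w| `^ (1 + e))%:E = C%:E)%E.

Let mean_below t : R := fine (\int[P]_w (trunc_below t (X 0%N w))%:E)%E.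

Let S t := marked_sum X Y (trunc_below t) (B t).
Let U t := marked_sum X Y (trunc_above t) (B t).
Let W t := marked_sum X Y Num.norm (B t).

(** The squared relative deviation of the sum of the truncated marks from its
mean, plus the relative contribution of the large marks. *)
Let fluctuation t w : \bar R :=
  ((S t w - (mean_below t * (t * c))%:E) * (S t w - (mean_below t * (t * c))%:E)
     * (t ^- 2)%:E + U t w * (t^-1)%:E)%E.

Let term_ge0 (g : R -> R) (D : set T) i w : (forall x, 0 <= g x) ->
  (0 <= (g (X i w) * \1_D (Y i w))%:E)%E.
Proof. by move=> g0; rewrite lee_fin mulr_ge0// indicE. Qed.

Let WE t w : W t w = (S t w + U t w)%E.
Proof.
rewrite /W /S /U /marked_sum -nneseriesD//; last 2 first.
- by move=> i _ _; apply: term_ge0; exact: trunc_below_ge0.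
- by move=> i _ _; apply: term_ge0; exact: trunc_above_ge0.
by apply: eq_eseriesr => i _; rewrite -EFinD -mulrDl trunc_split.
Qed.

Let nd_W w s t : 0 < s -> s <= t -> (W s w <= W t w)%E.
Proof.
move=> s0 st; apply: lee_nneseries => [i _ _|i _]; first exact: term_ge0.
rewrite lee_fin ler_wpM2l//.
rewrite !indicE ler_nat; case: (boolP (_ \in B s)) => // /set_mem Ys.
by rewrite mem_set//; exact: (ndB s0 st).
Qed.

Let mX0 (g : R -> R) : measurable_fun setT g ->
  measurable_fun setT (fun w => (g (X 0%N w))%:E).
Proof. by move=> mg; apply/measurable_EFinP; exact: measurableT_comp. Qed.

Let C_ge0 : 0 <= C.
Proof. by rewrite -lee_fin -EC; apply: integral_ge0 => w _; rewrite lee_fin powR_ge0. Qed.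

Let m_norm : measurable_fun setT (Num.norm : R -> R).
Proof. exact: normr_measurable. Qed.

Let m_pow : measurable_fun setT (fun x : R => `|x| `^ (1 + e)).
Proof. by apply: (measurableT_comp (measurable_powR _)). Qed.

Let mean_belowE t : (\int[P]_w (trunc_below t (X 0%N w))%:E = (mean_below t)%:E)%E.
Proof.
rewrite fineK// ge0_fin_numE; last first.
  by apply: integral_ge0 => w _; rewrite lee_fin trunc_below_ge0.
apply: (@le_lt_trans _ _ m%:E); last exact: ltry.
rewrite -Em; apply: ge0_le_integral => //.
- by move=> w _; rewrite lee_fin trunc_below_ge0.
- by apply: mX0; exact: measurable_trunc_below.
- exact: mX0.
- by move=> w _; rewrite lee_fin -(trunc_split t) lerDl trunc_above_ge0.
Qed.

Let mean_below_ge0 t : 0 <= mean_below t.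
Proof.
by rewrite -lee_fin -mean_belowE; apply: integral_ge0 => w _; rewrite lee_fin trunc_below_ge0.
Qed.

Let mean_above t :
  (\int[P]_w (trunc_above t (X 0%N w))%:E = (m - mean_below t)%:E)%E.
Proof.
have E : (m%:E = \int[P]_w (trunc_above t (X 0%N w))%:E + (mean_below t)%:E)%E.
  have ma := mX0 (@measurable_trunc_above _ t).
  have mb := mX0 (@measurable_trunc_below _ t).
  have a0 w : (0 <= (trunc_above t (X 0%N w))%:E)%E by rewrite lee_fin trunc_above_ge0.
  have b0 w : (0 <= (trunc_below t (X 0%N w))%:E)%E by rewrite lee_fin trunc_below_ge0.
  rewrite -mean_belowE -ge0_integralD//.
  by rewrite -Em; apply: eq_integral => w _; rewrite -EFinD addrC trunc_split.
by rewrite EFinB E addeK.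
Qed.

Let mean_above_le t : 0 < t -> m - mean_below t <= C / t `^ e.
Proof.
move=> t0; have /andP[e0 _] := e01.
have mp := mX0 m_pow.
have p0 w : (0 <= (`|X 0%N w| `^ (1 + e))%:E)%E by rewrite lee_fin powR_ge0.
have te0 : (0 <= ((t `^ e)^-1)%:E)%E by rewrite lee_fin invr_ge0 powR_ge0.
rewrite -lee_fin -mean_above mulrC EFinM -EC -ge0_integralZl//.
apply: ge0_le_integral => //.
- by move=> w _; rewrite lee_fin trunc_above_ge0.
- by apply: mX0; exact: measurable_trunc_above.
- by apply: emeasurable_funM => //; apply: mX0; exact: m_pow.
- by move=> w _; rewrite -EFinM lee_fin mulrC trunc_above_le.
Qed.

(** The last bound is Jensen's inequality for the square. *)
Let second_moment_below t : 0 < t -> exists2 s : R,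
  (\int[P]_w (trunc_below t (X 0%N w) ^+ 2)%:E = s%:E)%E &
  s <= t / t `^ e * C /\ mean_below t ^+ 2 <= s.
Proof.
move=> t0.
have msq : measurable_fun setT (fun w => (trunc_below t (X 0%N w) ^+ 2)%:E).
  by apply: (mX0 (g := fun x => trunc_below t x ^+ 2)); apply: measurable_funX;
    exact: measurable_trunc_below.
have up : (\int[P]_w (trunc_below t (X 0%N w) ^+ 2)%:E <= (t / t `^ e * C)%:E)%E.
  have mp := mX0 m_pow.
  have p0 w : (0 <= (`|X 0%N w| `^ (1 + e))%:E)%E by rewrite lee_fin powR_ge0.
  have te0 : (0 <= (t / t `^ e)%:E)%E by rewrite lee_fin divr_ge0 ?powR_ge0// ltW.
  rewrite EFinM -EC -ge0_integralZl//.
  apply: ge0_le_integral => //.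
  - by move=> w _; rewrite lee_fin sqr_ge0.
  - by apply: emeasurable_funM => //; apply: mX0; exact: m_pow.
  - by move=> w _; rewrite -EFinM lee_fin trunc_below_sqr_le.
have lo : (0 <= \int[P]_w (trunc_below t (X 0%N w) ^+ 2)%:E)%E.
  by apply: integral_ge0 => w _; rewrite lee_fin sqr_ge0.
move: up lo.
case Es : (\int[P]_w (trunc_below t (X 0%N w) ^+ 2)%:E)%E => [s| |]//.
rewrite !lee_fin => up s0; exists s => //; split => //.
set a := mean_below t.
have : ((2 * a * a)%:E <= (s + a ^+ 2)%:E)%E; last by rewrite lee_fin; nra.
have a0 : 0 <= a := mean_below_ge0 t.
have Ea : (\int[P]_w (a ^+ 2)%:E = (a ^+ 2)%:E)%E.
  rewrite integral_cst//; transitivity ((a ^+ 2)%:E * 1)%E; last by rewrite mule1.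
  by congr (_ * _)%E; exact: probability_setT.
have mb := mX0 (@measurable_trunc_below _ t).
have b0 w : (0 <= (trunc_below t (X 0%N w))%:E)%E by rewrite lee_fin trunc_below_ge0.
have a20 : (0 <= (2 * a)%:E)%E by rewrite lee_fin mulr_ge0.
have sq0 w : (0 <= (trunc_below t (X 0%N w) ^+ 2)%:E)%E by rewrite lee_fin sqr_ge0.
have asq0 (w : Omega) : (0 <= (a ^+ 2)%:E)%E by rewrite lee_fin sqr_ge0.
rewrite EFinD -Ea -Es EFinM -{2}/a -(mean_belowE t) -ge0_integralZl//.
rewrite -ge0_integralD//.
apply: ge0_le_integral => //.
- by move=> w _; rewrite mule_ge0// lee_fin ?mulr_ge0// trunc_below_ge0.
- by apply: emeasurable_funM => //; apply: mX0; exact: measurable_trunc_below.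
- by apply: emeasurable_funD.
- move=> w _; rewrite -EFinM -EFinD lee_fin.
  exact: double_mul_le_sqr.
by move=> w _; rewrite lee_fin sqr_ge0.
Qed.

Let fluctuation_ge0 t w : 0 < t -> (0 <= fluctuation t w)%E.
Proof.
move=> t0; rewrite /fluctuation adde_ge0// mule_ge0//.
- exact: sqre_ge0.
- by rewrite lee_fin invr_ge0 exprn_ge0// ltW.
- by apply: marked_sum_ge0; exact: trunc_above_ge0.
- by rewrite lee_fin invr_ge0 ltW.
Qed.

Let measurable_S t : 0 < t -> measurable_fun setT (S t).
Proof.
move=> t0; apply: measurable_marked_sum; first exact: mB.
  exact: measurable_trunc_below.
exact: trunc_below_ge0.
Qed.

Let measurable_U t : 0 < t -> measurable_fun setT (U t).
Proof.
move=> t0; apply: measurable_marked_sum; first exact: mB.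
  exact: measurable_trunc_above.
exact: trunc_above_ge0.
Qed.

Let measurable_fluctuation t : 0 < t -> measurable_fun setT (fluctuation t).
Proof.
move=> t0; apply: emeasurable_funD; apply: emeasurable_funM => //.
  by apply: emeasurable_funM; apply: emeasurable_funB => //; exact: measurable_S.
exact: measurable_U.
Qed.

(** The variance bound contributes two thirds of the right-hand side and the
large marks the remaining third. *)
Let expectation_fluctuation t : 0 < t ->
  (\int[P]_w fluctuation t w <= (3 * c * C / t `^ e)%:E)%E.
Proof.
move=> t0; have tc : 0 <= t * c by rewrite mulr_ge0// ltW.
have te : 0 < t `^ e by exact: powR_gt0.
have mSS : measurable_fun setT (fun w => (S t w - (mean_below t * (t * c))%:E) *
    (S t w - (mean_below t * (t * c))%:E))%E.
  by apply: emeasurable_funM; apply: emeasurable_funB => //; exact: measurable_S.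
have mU := measurable_U t0.
have U0 w : (0 <= U t w)%E by apply: marked_sum_ge0; exact: trunc_above_ge0.
have t2 : (0 <= (t ^- 2)%:E)%E by rewrite lee_fin invr_ge0 exprn_ge0// ltW.
have t1 : (0 <= (t^-1)%:E)%E by rewrite lee_fin invr_ge0 ltW.
have SS0 w : (0 <= (S t w - (mean_below t * (t * c))%:E) *
    (S t w - (mean_below t * (t * c))%:E))%E by exact: sqre_ge0.
rewrite ge0_integralD//; first last.
- exact: emeasurable_funM.
- by move=> w _; rewrite mule_ge0.
- exact: emeasurable_funM.
- by move=> w _; rewrite mule_ge0.
rewrite ge0_integralZr//.
rewrite ge0_integralZr//.
have -> : (\int[P]_w U t w = ((m - mean_below t) * (t * c))%:E)%E.
  by apply: expectation_marked_sum => //; first [exact: mB|exact: poissonB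
    |exact: mean_above|exact: measurable_trunc_above|exact: trunc_above_ge0].
have [s Es [s_up ms]] := second_moment_below t0.
have V := @marked_sum_variance _ _ _ _ _ P X Y X_indep X_ident X_Y (B t) (t * c)
  (trunc_below t) (mB t0) tc (poissonB t0) (@measurable_trunc_below _ t)
  (@trunc_below_ge0 _ t) (mean_below t) s (mean_belowE t) Es ms.
apply: (@le_trans _ _ ((2 * s * (t * c))%:E * (t ^- 2)%:E +
   ((m - mean_below t) * (t * c))%:E * (t^-1)%:E)%E).
  by rewrite leeD2r// lee_wpmul2r.
rewrite -!EFinM -EFinD lee_fin.
have tn0 : t != 0 by rewrite gt_eqF.
have -> : 2 * s * (t * c) * t ^- 2 + (m - mean_below t) * (t * c) * t^-1 =
   2 * c * (s / t) + c * (m - mean_below t) by field.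
have h1 : s / t <= C / t `^ e.
  by rewrite ler_pdivrMr// (_ : C / t `^ e * t = t / t `^ e * C)//; ring.
have h2 := mean_above_le t0.
have -> : 3 * c * C / t `^ e = 2 * c * (C / t `^ e) + c * (C / t `^ e) by ring.
by rewrite lerD// ler_wpM2l// mulr_ge0.
Qed.

Let fluctuation_control t w eta : 0 < t -> 0 < eta <= 1 ->
  (fluctuation t w <= (eta ^+ 2)%:E)%E ->
  ((mean_below t * (t * c) - eta * t)%:E <= W t w <=
   (mean_below t * (t * c) + 2 * eta * t)%:E)%E.
Proof.
move=> t0 /andP[eta0 eta1]; rewrite WE /fluctuation.
have S0 : (0 <= S t w)%E by apply: marked_sum_ge0; exact: trunc_below_ge0.
have U0 : (0 <= U t w)%E by apply: marked_sum_ge0; exact: trunc_above_ge0.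
set a := mean_below t * (t * c).
have t2 : 0 < t ^- 2 by rewrite invr_gt0 exprn_gt0.
have t1 : 0 < t^-1 by rewrite invr_gt0.
move: S0 U0; case: (S t w) => [s| |]//; last first.
  move=> _; case: (U t w) => [u| |]// _; rewrite ?mulyy ?gt0_mulye ?lte_fin//.
case: (U t w) => [u| |]// s0 u0; last by rewrite gt0_mulye ?lte_fin// addey.
rewrite !lee_fin in s0 u0 *.
move=> h.
have u1 : 0 <= u * t^-1 by rewrite mulr_ge0// ltW.
have sq : 0 <= (s - a) * (s - a) * t ^- 2 by apply: mulr_ge0; [exact: sqr_ge0|exact: ltW].
have hu : u <= eta * t.
  rewrite -ler_pdivrMr//; have : eta ^+ 2 <= eta by rewrite expr2 ler_piMl// ltW.
  by lra.
have hs : `|s - a| <= eta * t.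
  rewrite -(@ler_pXn2r _ 2)// ?nnegrE//; last by rewrite mulr_ge0// ltW.
  rewrite real_normK ?num_real// exprMn -ler_pdivrMr ?exprn_gt0// expr2.
  by lra.
move: hs; rewrite ler_norml => /andP[h1 h2].
by apply/andP; split; lra.
Qed.

(** Almost sure convergence of [W t / t]. Summability of the expected
fluctuations along the times [k.+1 ^+ q] replaces a Borel-Cantelli argument. *)
Lemma marked_sum_slln : {ae P, forall w, forall delta : R, 0 < delta ->
  \forall t \near +oo,
    (((m * c - delta) * t)%:E <= marked_sum X Y Num.norm (B t) w <=
     ((m * c + delta) * t)%:E)%E}.
Proof.
have /andP[e0 e1] := e01.
(* With [2 <= q * e], the bound of order [t `^ - e] at [t = k.+1 ^+ q] is at
   most of order [k.+1 ^- 2]. *)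
pose q := (Num.truncn (2 / e)).+1.
have q2 : 2 <= q%:R * e.
  by rewrite -ler_pdivrMr// ltW// truncnS_gt.
pose tk k : R := k.+1%:R ^+ q.
have tk0 k : 0 < tk k by rewrite exprn_gt0.
have tke k : k.+1%:R ^+ 2 <= tk k `^ e.
  rewrite /tk -powR_mulrn// -powRrM -powR_mulrn// ler_powR//.
  by rewrite ler1n.
have int_sum : (\int[P]_w (\sum_(k <oo) fluctuation (tk k) w) < +oo)%E.
  rewrite integral_nneseries//; last 2 first.
  - by move=> k; exact: measurable_fluctuation.
  - by move=> k w _; exact: fluctuation_ge0.
  apply: le_lt_trans (@sum_inverse_squares_lty R (3 * c * C) _); last by rewrite !mulr_ge0.
  apply: lee_nneseries => [k _ _|k _].
    by apply: integral_ge0 => w _; exact: fluctuation_ge0.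
  apply: (le_trans (expectation_fluctuation (tk0 k))); rewrite lee_fin ler_wpM2l//.
    by rewrite !mulr_ge0.
  by rewrite lef_pV2 ?posrE// powR_gt0.
have sum_ge0 w : (0 <= \sum_(k <oo) fluctuation (tk k) w)%E.
  by apply: nneseries_ge0 => k _ _; exact: fluctuation_ge0.
have int_fluct : P.-integrable setT (fun w => \sum_(k <oo) fluctuation (tk k) w)%E.
  apply/integrableP; split.
    apply: (@ge0_emeasurable_sum _ _ _ _ _ xpredT) => [k w _ _|k _].
      exact: fluctuation_ge0.
    exact: measurable_fluctuation.
  by under eq_integral do rewrite gee0_abs//.
have := integrable_ae measurableT int_fluct.
apply: filterS => w /(_ I) sum_fin.
apply: (@poly_time_interpolation _ (fun t => W t w) _ q) => //.
- rewrite mulr_ge0// -lee_fin -Em; apply: integral_ge0 => v _; by rewrite lee_fin.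
- by move=> s t s0 st; exact: nd_W.
move=> delta delta0.
pose eta := Num.min 1 (delta / (c + 2)).
have c2 : 0 < c + 2 by rewrite ltr_wpDl.
have eta0 : 0 < eta by rewrite lt_min ltr01 divr_gt0.
have eta1 : eta <= 1 by rewrite ge_min lexx.
have etac : eta * (c + 2) <= delta by rewrite -ler_pdivlMr// ge_min lexx orbT.
have eta2 : 0 < eta ^+ 2 by rewrite exprn_gt0.
have tail : (\sum_(N <= k <oo) fluctuation (tk k) w @[N --> \oo] --> 0)%E.
  apply: nneseries_tail_cvg; first by rewrite ltey_eq sum_fin.
  by move=> k _; exact: fluctuation_ge0.
have {}tail : \forall N \near \oo,
    (\sum_(N <= k <oo) fluctuation (tk k) w < (eta ^+ 2)%:E)%E.
  have := tail [set x | (x < (eta ^+ 2)%:E)%E]; apply.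
  by apply: open_ereal_lt'; rewrite lte_fin.
have small : \forall k \near \oo, C / k.+1%:R ^+ 2 <= eta.
  have C1 : 0 < C + 1 by rewrite ltr_wpDl.
  near=> k.
  have hk : harmonic k < eta / (C + 1).
    near: k; apply: (cvgr_lt _ (@cvg_harmonic R)); exact: divr_gt0.
  apply: (@le_trans _ _ ((C + 1) * harmonic k)); last first.
    by rewrite mulrC -ler_pdivlMr// ltW.
  rewrite ler_pM// ?invr_ge0 ?exprn_ge0//; first by rewrite lerDl.
  by rewrite lef_pV2 ?posrE// ?exprn_gt0 ?ltr0n expr2 ler_peMr ?ler1n ?ler0n ?ltr0n.
near=> k.
have ctrl : (fluctuation (tk k) w <= (eta ^+ 2)%:E)%E.
  apply: (@le_trans _ _ (\sum_(k <= j <oo) fluctuation (tk j) w)%E).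
    rewrite (@nneseries_split _ _ k 1)//; last by move=> j _; exact: fluctuation_ge0.
    rewrite addn1 big_nat1 leeDl//; apply: nneseries_ge0 => j _ _; exact: fluctuation_ge0.
  by apply: ltW; near: k.
have ck : C / k.+1%:R ^+ 2 <= eta by near: k.
have /andP[lo up] := @fluctuation_control _ w eta (tk0 k) (introT andP (conj eta0 eta1)) ctrl.
have mk : m - mean_below (tk k) <= eta.
  apply: (le_trans (mean_above_le (tk0 k))); apply: le_trans ck.
  by rewrite ler_wpM2l// lef_pV2 ?posrE// powR_gt0.
have mk0 : 0 <= m - mean_below (tk k).
  by rewrite -lee_fin -mean_above; apply: integral_ge0 => v _; rewrite lee_fin trunc_above_ge0.
apply/andP; split.
  apply: le_trans lo; rewrite lee_fin -/(tk k).
  have := tk0 k; set t := tk k => t0.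
  have h1 : (m - mean_below t) * (t * c) <= eta * (t * c) by rewrite ler_wpM2r// mulr_ge0// ltW.
  have h2 : eta * (c + 2) * t <= delta * t by rewrite ler_wpM2r// ltW.
  have h3 : 0 <= eta * t by rewrite mulr_ge0// ltW.
  exact: lower_estimate h1 h2 h3.
apply: (le_trans up); rewrite lee_fin -/(tk k).
have := tk0 k; set t := tk k => t0.
have h1 : 0 <= (m - mean_below t) * (t * c) by rewrite mulr_ge0// mulr_ge0// ltW.
have h2 : eta * (c + 2) * t <= delta * t by rewrite ler_wpM2r// ltW.
have h3 : 0 <= eta * c * t by rewrite !mulr_ge0// ltW.
exact: upper_estimate h1 h2 h3.
Unshelve. all: by end_near. Qed.

End marked_sum_slln.

(** * The passage time from the origin in closed form *)

Section euclidean.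
Context {R : realType} {d : nat}.
Implicit Types (x y u : 'rV[R]_d) (a : R).

Lemma dotC x y : dot x y = dot y x.
Proof. by apply: eq_bigr => i _; rewrite mulrC. Qed.

Lemma dotZl a x y : dot (a *: x) y = a * dot x y.
Proof. by rewrite /dot mulr_sumr; apply: eq_bigr => i _; rewrite mxE mulrA. Qed.

Lemma dotDl x y u : dot (x + y) u = dot x u + dot y u.
Proof. by rewrite /dot -big_split; apply: eq_bigr => i _; rewrite mxE mulrDl. Qed.

Lemma dotNl x u : dot (- x) u = - dot x u.
Proof. by rewrite -scaleN1r dotZl mulN1r. Qed.

Lemma dot0l u : dot 0 u = 0.
Proof. by rewrite -(scale0r 0) dotZl mul0r. Qed.

Lemma dot_ge0 x : 0 <= dot x x.
Proof. by apply: sumr_ge0 => i _; rewrite -expr2 sqr_ge0. Qed.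

Lemma enorm_ge0 x : 0 <= enorm x.
Proof. exact: sqrtr_ge0. Qed.

Lemma enormZ a x : enorm (a *: x) = `|a| * enorm x.
Proof.
by rewrite /enorm dotZl dotC dotZl mulrA -expr2 sqrtrM ?sqr_ge0// sqrtr_sqr.
Qed.

Lemma enorm_coord x i : `|x 0 i| <= enorm x.
Proof.
rewrite -sqrtr_sqr ler_wsqrtr// expr2 /dot (bigD1 i)//= lerDl.
by apply: sumr_ge0 => j _; rewrite -expr2 sqr_ge0.
Qed.

Lemma enorm_eq0 x : enorm x = 0 -> x = 0.
Proof.
move=> x0; apply/rowP => i; rewrite mxE; apply/eqP; rewrite -normr_le0 -x0.
exact: enorm_coord.
Qed.

Lemma enorm_gt0 x : x != 0 -> 0 < enorm x.
Proof.
move=> x0; rewrite lt_neqAle enorm_ge0 andbT eq_sym; apply: contra x0 => /eqP.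
by move/enorm_eq0/eqP.
Qed.

Lemma dot_sphere_le x u : unit_sphere u -> `|dot x u| <= \sum_(i < d) `|x 0 i|.
Proof.
move=> u1; apply: (le_trans (ler_norm_sum _ _ _)); apply: ler_sum => i _.
by rewrite normrM ler_piMr// -[leRHS]u1 enorm_coord.
Qed.

Lemma continuous_dot u : continuous (fun x => dot x u).
Proof.
rewrite /dot; apply: continuous_big => [|i _]; first exact: add_continuous.
move=> x; apply: cvgM; [exact: nbhs_filter|exact: (@coord_continuous R)|].
by apply: cvg_cst; exact: nbhs_filter.
Qed.

End euclidean.

Section passage_time_formula.
Context {R : realType} {d : nat}.
Variables (p : nat -> borel_rV R d * R) (X : nat -> R).
Hypothesis p_ge0 : forall i, 0 <= (p i).2.
Hypothesis X_ge0 : forall i, 0 <= X i.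

(** Hyperplanes through the origin are included, as every curve leaving 0 meets
them at its starting point. *)
Definition separates (x : 'rV[R]_d) (i : nat) : bool :=
  ((p i).2 == 0) || ((p i).2 < dot x (p i).1).

Let E i := hyperplane (p i).

(** A hyperplane through the origin is met at time 0; any other separating one
is met by the intermediate value theorem. In both cases the point met differs
from the endpoint. *)
Lemma separates_crossing (x : 'rV[R]_d) (c : R -> 'rV[R]_d) i :
  x != 0 -> curves 0 x c -> separates x i ->
  ((c @` `[0, 1]) `\ c 1) `&` E i !=set0.
Proof.
move=> x0 [c_cont c0 c1] /orP[/eqP pi0|pix].
  exists 0; split; last by rewrite /E /hyperplane/= dot0l pi0.
  split; first by exists 0 => //=; rewrite in_itv/= lexx ler01.
  by rewrite /= c1; apply/eqP; rewrite eq_sym.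
pose g t := dot (c t) (p i).1.
have g_cont : {within `[0, 1], continuous g}.
  move=> t; apply: (@continuous_comp _ _ _ (c : subspace `[0, 1] -> _)
     (fun x : 'rV[R]_d => dot x (p i).1)); first exact: c_cont.
  exact: continuous_dot.
have [|t t01 gt] := IVT ler01 g_cont (v := (p i).2).
  by rewrite /g c0 c1 dot0l ge_min p_ge0/= le_max (ltW pix) orbT.
exists (c t); split => //; split; first by exists t.
move=> /= ct; move: gt; rewrite /g ct c1 => gt.
by move: pix; rewrite gt ltxx.
Qed.

Lemma segment_crossing (x : 'rV[R]_d) i : x != 0 ->
  (((fun t : R => t *: x) @` `[0, 1]) `\ (1 *: x)) `&` E i !=set0 -> separates x i.
Proof.
move=> x0 [y [[[t /= + <-] tx]]]; rewrite in_itv/= => /andP[t0 t1].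
rewrite /E /hyperplane/= dotZl /separates => tp.
have tlt1 : t < 1.
  by rewrite lt_neqAle t1 andbT; apply/eqP => t1'; apply: tx; rewrite t1'.
have := p_ge0 i; rewrite le_eqVlt eq_sym => /orP[->//|p0].
apply/orP; right; rewrite -tp in p0 *.
have t0' : 0 < t.
  by rewrite lt_neqAle t0 andbT; apply: contraTN p0 => /eqP <-; rewrite mul0r ltxx.
by rewrite gtr_pMl// -(pmulr_rgt0 _ t0').
Qed.

Lemma passage_timeE (x : 'rV[R]_d) : x != 0 ->
  passage_time E X 0 x = (\sum_(i <oo | separates x i) (X i)%:E)%E.
Proof.
move=> x0; apply/eqP; rewrite eq_le; apply/andP; split; last first.
  apply/ereal_infP => _ [c xc <-].
  apply: subset_lee_nneseries => [i _|i sep]; first by rewrite lee_fin.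
  by apply/asboolP; exact: (separates_crossing x0 xc sep).
pose c := fun t : R => t *: x.
have xc : curves 0 x c.
  split; rewrite /c ?scale0r ?scale1r//.
  by apply: continuous_subspaceT => t; apply: cvgZl; exact: cvg_id.
apply: (@le_trans _ _ (crossing_length E X c)).
  by apply: ereal_inf_lbound; exists c.
apply: subset_lee_nneseries => [i _|i /asboolP]; first by rewrite lee_fin.
exact: segment_crossing.
Qed.

Lemma passage_time_diag : passage_time E X 0 0 = 0%E.
Proof.
have ge0 : (0 <= passage_time E X 0 0)%E.
  apply/ereal_infP => _ [c _ <-]; apply: nneseries_ge0 => i _ _.
  by rewrite lee_fin.
apply/eqP; rewrite eq_le ge0 andbT.
have xc : curves 0 0 (cst (0 : 'rV[R]_d)).
  by split => //; apply: continuous_subspaceT => t; exact: cvg_cst.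
apply: (@le_trans _ _ (crossing_length E X (cst 0))).
  by apply: ereal_inf_lbound; exists (cst 0).
rewrite /crossing_length eseries_pred0// => i; apply/negbTE/negP => /asboolP.
by move=> [y [[[t _ <-]] /=]].
Qed.

(** Moving outwards along a ray only adds separating hyperplanes. *)
Lemma passage_time_ray (x : 'rV[R]_d) (a : R) : 1 <= a ->
  (passage_time E X 0 x <= passage_time E X 0 (a *: x))%E.
Proof.
move=> a1; have [->|x0] := eqVneq x 0; first by rewrite scaler0.
rewrite !passage_timeE ?scaler_eq0 ?negb_or ?x0 ?andbT//; last by rewrite gt_eqF//; lra.
apply: subset_lee_nneseries => [i _|i]; first by rewrite lee_fin.
rewrite /separates => /orP[->//|px]; apply/orP; right; apply: (lt_le_trans px).
rewrite dotZl ler_peMl//; exact: le_trans (p_ge0 i) (ltW px).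
Qed.

Lemma separates_sum_le (x : 'rV[R]_d) (D : set (borel_rV R d * R)) :
  (forall i, separates x i -> D (p i)) ->
  (\sum_(i <oo | separates x i) (X i)%:E <= \sum_(i <oo) (`|X i| * \1_D (p i))%:E)%E.
Proof.
move=> sD; rewrite eseries_mkcond; apply: lee_nneseries => [i _ _|i _].
  by case: ifP => // _; rewrite lee_fin.
case: ifP => [si|_]; last by rewrite lee_fin mulr_ge0// indicE.
by rewrite indicE mem_set ?mulr1 ?ger0_norm//; exact: sD.
Qed.

Lemma separates_sum_ge (x : 'rV[R]_d) (D : set (borel_rV R d * R)) :
  (forall i, D (p i) -> separates x i) ->
  (\sum_(i <oo) (`|X i| * \1_D (p i))%:E <= \sum_(i <oo | separates x i) (X i)%:E)%E.
Proof.
move=> Ds; rewrite [leRHS]eseries_mkcond; apply: lee_nneseries => [i _ _|i _].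
  by rewrite lee_fin mulr_ge0// indicE.
rewrite indicE; case: (boolP (p i \in D)) => [/set_mem/Ds ->|_].
  by rewrite mulr1 ger0_norm.
by rewrite mulr0; case: ifP => // _; rewrite lee_fin.
Qed.

(** As [r >= 0], the hyperplane meets the closed segment from 0 to [x] exactly
when [r <= max(0, <x,u>)], the value 0 standing for a hyperplane through the
origin. *)
Lemma hitting_numberE (x : 'rV[R]_d) :
  hitting_number E x =
  (\sum_(i <oo) (\d_(p i) [set q | (q.2 <= Num.max 0 (dot x (q.1 : 'rV[R]_d)))%R] : \bar R))%E.
Proof.
rewrite /hitting_number eseries_mkcond; apply: eq_eseriesr => i _.
rewrite diracE; case: asboolP => [|nhit].
  move=> [y [[t /= + <-]]]; rewrite in_itv/= => /andP[t0 t1].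
  rewrite /E /hyperplane/= dotZl => tp; rewrite mem_set//=.
  rewrite le_max -tp; have [xp|xp] := leP (dot x (p i).1) 0.
    by rewrite mulr_ge0_le0.
  by rewrite orbC ler_piMl// ltW.
rewrite memNset//= => pi_le; apply: nhit.
have := p_ge0 i; rewrite le_eqVlt => /orP[/eqP p0|p0].
  exists 0; split; last by rewrite /E /hyperplane/= dot0l.
  by exists 0 => /=; rewrite ?scale0r// in_itv/= lexx ler01.
move: pi_le; rewrite le_max leNgt p0/= => px.
have x0 : 0 < dot x (p i).1 by exact: lt_le_trans px.
exists (((p i).2 / dot x (p i).1) *: x); split.
  exists ((p i).2 / dot x (p i).1) => //=.
  by rewrite in_itv/= ler_pdivrMr// mul1r px andbT divr_ge0// ltW.
by rewrite /E /hyperplane/= dotZl divfK// gt_eqF.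
Qed.

End passage_time_formula.

(** * Intensity of the region below a radial function *)

Section borel_rV.
Context {R : realType} {d : nat}.

Lemma continuous_borel_rV (f : 'rV[R]_d -> R) : continuous f ->
  measurable_fun setT (f : borel_rV R d -> R).
Proof.
move=> /continuousP cf; apply: (measurability _ (RGenOpens.measurableE R)).
move=> _ [_ [a [b ->] <-]]; rewrite setTI; apply: sub_sigma_algebra.
exact/cf/interval_open.
Qed.

Lemma continuous_dotr (x : 'rV[R]_d) : continuous (fun u => dot x u).
Proof.
rewrite (_ : (fun u => dot x u) = fun u => dot u x); first exact: continuous_dot.
by apply/funext => u; exact: dotC.
Qed.

Lemma measurable_dotr (x : 'rV[R]_d) :
  measurable_fun setT (fun u : borel_rV R d => dot x u).
Proof. by apply: continuous_borel_rV; exact: continuous_dotr. Qed.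

Lemma continuous_dot_diag : continuous (fun x : 'rV[R]_d => dot x x).
Proof.
rewrite /dot; apply: continuous_big => [|i _]; first exact: add_continuous.
by move=> x; apply: cvgM;
  [exact: nbhs_filter|exact: (@coord_continuous R)|exact: (@coord_continuous R)].
Qed.

Lemma unit_sphereE : @unit_sphere R d = (fun x => dot x x) @^-1` [set 1].
Proof.
apply/seteqP; split => x /=; rewrite /unit_sphere /enorm /= => h.
  by rewrite -(sqr_sqrtr (dot_ge0 x)) h expr1n.
by rewrite h sqrtr1.
Qed.

Lemma closed_unit_sphere : closed (@unit_sphere R d).
Proof.
rewrite unit_sphereE; apply: preimage_closed => //.
  by move=> x _; exact: continuous_dot_diag.
Qed.

Lemma compact_unit_sphere : compact (@unit_sphere R d).
Proof.
apply: bounded_closed_compact; last exact: closed_unit_sphere.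
exists 1; split; first exact: num_real.
move=> M M1 x x1; apply: (le_trans _ (ltW M1)).
change (mx_norm x <= 1).
have [->//|/mx_norm_neq0[[i j] ->]/=] := eqVneq (mx_norm x) 0.
by rewrite (ord1 i) -[leRHS]x1 enorm_coord.
Qed.

Lemma measurable_unit_sphere : measurable (@unit_sphere R d : set (borel_rV R d)).
Proof.
rewrite unit_sphereE -[X in measurable X]setTI.
by apply: (continuous_borel_rV continuous_dot_diag) => //; exact: measurable_set1.
Qed.

Definition below (f : borel_rV R d -> R) : set (borel_rV R d * R) :=
  [set q | q.2 <= f q.1].

Lemma measurable_below (f : borel_rV R d -> R) :
  measurable_fun setT f -> measurable (below f).
Proof.
move=> mf.
have mle : measurable_fun setT (fun q : borel_rV R d * R => q.2 <= f q.1).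
  by apply: measurable_fun_ler => //; exact: measurableT_comp.
have := mle measurableT [set true] I; rewrite setTI.
by congr (measurable _); apply/seteqP; split => q.
Qed.

End borel_rV.

Section directional_mean.
Context {R : realType} {d : nat}.
Variable phi : probability (borel_rV R d) R.
Hypothesis phi_sphere : phi (@unit_sphere R d) = 1%E.
Local Notation T := (borel_rV R d).
Local Notation sphere := (@unit_sphere R d : set T).
Implicit Types f g : T -> R.

(** The bound is only required on the sphere, which carries the directional
distribution; a linear functional is unbounded on the ambient space. *)
Definition bounded_direction f := [/\ measurable_fun setT f, forall u, 0 <= f u &
  exists K, forall u, unit_sphere (u : 'rV[R]_d) -> f u <= K].

Definition mean f : R := fine (\int[phi]_u (f u)%:E)%E.

(** Allows bounds valid only on the sphere to be integrated. *)
Lemma integral_sphere f : measurable_fun setT f -> (forall u, 0 <= f u) ->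
  (\int[phi]_u (f u)%:E = \int[phi]_(u in sphere) (f u)%:E)%E.
Proof.
move=> mf f0; have mS := @measurable_unit_sphere R d.
rewrite (@ge0_negligible_integral _ _ _ _ _ (~` sphere))//.
- by rewrite setTD setCK.
- exact: measurableC.
- exact/measurable_EFinP.
- by move=> u _; rewrite lee_fin.
- have PT := probability_setC phi mS.
  by transitivity (1 - phi sphere)%E; [exact: PT|rewrite phi_sphere subee].
Qed.

Lemma integral_cst_sphere (K : R) :
  (\int[phi]_(u in sphere) K%:E = K%:E)%E.
Proof.
have mS := @measurable_unit_sphere R d.
rewrite integral_cst//; transitivity (K%:E * 1)%E; last by rewrite mule1.
by congr (_ * _)%E; exact: phi_sphere.
Qed.

Lemma integral_mean f : bounded_direction f ->
  (\int[phi]_u (f u)%:E = (mean f)%:E)%E.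
Proof.
move=> [mf f0 [K fK]]; rewrite fineK// ge0_fin_numE; last first.
  by apply: integral_ge0 => u _; rewrite lee_fin.
apply: (@le_lt_trans _ _ `|K|%:E); last exact: ltry.
rewrite integral_sphere// -(integral_cst_sphere `|K|).
apply: ge0_le_integral => //.
- exact: measurable_unit_sphere.
- by move=> u _; rewrite lee_fin.
- by apply/measurable_EFinP; exact: measurable_funTS.
- by move=> u u1; rewrite lee_fin (le_trans (fK u u1))// ler_norm.
Qed.

Lemma mean_ge0 f : bounded_direction f -> 0 <= mean f.
Proof.
move=> bf; rewrite -lee_fin -integral_mean//.
by apply: integral_ge0 => u _; rewrite lee_fin; case: bf.
Qed.

Lemma mean_cst (K : R) : 0 <= K -> mean (cst K) = K.
Proof.
by move=> K0; rewrite /mean integral_sphere// integral_cst_sphere.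
Qed.

Lemma mean_le_add f g h : bounded_direction f -> bounded_direction g ->
  bounded_direction h ->
  (forall u, unit_sphere (u : 'rV[R]_d) -> f u <= g u + h u) ->
  mean f <= mean g + mean h.
Proof.
move=> bf bg bh fgh.
have [mf f0 _] := bf; have [mg g0 _] := bg; have [mh h0 _] := bh.
have meg : measurable_fun setT (fun u => (g u)%:E) by exact/measurable_EFinP.
have meh : measurable_fun setT (fun u => (h u)%:E) by exact/measurable_EFinP.
have eg0 u : (0 <= (g u)%:E)%E by rewrite lee_fin.
have eh0 u : (0 <= (h u)%:E)%E by rewrite lee_fin.
rewrite -lee_fin EFinD -!integral_mean// -ge0_integralD//.
under [leRHS]eq_integral do rewrite -EFinD.
rewrite (integral_sphere mf f0) (@integral_sphere (fun u => g u + h u)); last 2 first.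
- exact: measurable_funD.
- by move=> u; rewrite addr_ge0.
apply: ge0_le_integral => //.
- exact: measurable_unit_sphere.
- by move=> u _; rewrite lee_fin.
- by apply/measurable_EFinP; exact: measurable_funTS.
- by apply/measurable_EFinP/measurable_funTS; exact: measurable_funD.
Qed.

Lemma bounded_directionZ (t : R) f : 0 <= t -> bounded_direction f ->
  bounded_direction (fun u => t * f u).
Proof.
move=> t0 [mf f0 [K fK]]; split.
- exact: measurable_funM.
- by move=> u; rewrite mulr_ge0.
- by exists (t * K) => u u1; rewrite ler_wpM2l// fK.
Qed.

Lemma meanZ (t : R) f : 0 <= t -> bounded_direction f ->
  mean (fun u => t * f u) = t * mean f.
Proof.
move=> t0 bf; apply: EFin_inj.
rewrite EFinM -!integral_mean//; last exact: bounded_directionZ.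
have [mf f0 _] := bf.
have mef : measurable_fun setT (fun u => (f u)%:E) by exact/measurable_EFinP.
have ef0 u : (0 <= (f u)%:E)%E by rewrite lee_fin.
by rewrite -ge0_integralZl.
Qed.

Definition pos_dot (x : 'rV[R]_d) : T -> R := fun u => Num.max 0 (dot x u).

Lemma measurable_pos_dot x : measurable_fun setT (pos_dot x).
Proof. by apply: measurable_maxr => //; exact: measurable_dotr. Qed.

Lemma bounded_bracket (x : 'rV[R]_d) (c : R) :
  bounded_direction (fun u => Num.max 0 (dot x u + c)).
Proof.
split.
- by apply: measurable_maxr => //; apply: measurable_funD => //; exact: measurable_dotr.
- by move=> u; rewrite le_max lexx.
- exists (\sum_(i < d) `|x 0 i| + `|c|) => u u1.
  rewrite ge_max addr_ge0//=; last by rewrite sumr_ge0.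
  by rewrite lerD// (le_trans (ler_norm _))//; exact: dot_sphere_le.
Qed.

Lemma bounded_pos_dot (x : 'rV[R]_d) : bounded_direction (pos_dot x).
Proof.
rewrite /pos_dot (_ : (fun u => _) = fun u => Num.max 0 (dot x u + 0)).
  exact: bounded_bracket.
by apply/funext => u; rewrite addr0.
Qed.

Lemma mean_pos_dotZ (s : R) (x : 'rV[R]_d) : 0 <= s ->
  mean (pos_dot (s *: x)) = s * mean (pos_dot x).
Proof.
move=> s0; rewrite -meanZ//; last exact: bounded_pos_dot.
congr (mean _); apply/funext => u.
by rewrite /pos_dot dotZl maxr_pMr// mulr0.
Qed.

Lemma bounded_cst (K : R) : 0 <= K -> bounded_direction (cst K).
Proof. by move=> K0; split => //; exists K. Qed.

Variable gamma : R.

(** The section of the region above the direction [u] is the interval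
[[0, f u]]. *)
Lemma intensity_below f : bounded_direction f ->
  hyperplane_intensity phi gamma (below f) = (gamma * mean f)%:E.
Proof.
move=> bf; have [_ f0 _] := bf.
rewrite EFinM -integral_mean// /hyperplane_intensity; congr (_ * _)%E.
rewrite /product_measure1; apply: eq_integral => u _ /=.
rewrite (_ : xsection _ u = `[0, f u]%classic); last first.
  apply/seteqP; split => r /=; rewrite /xsection/= in_itv/= ?inE/=.
    by move=> [ru [_]]; rewrite in_itv/= andbT => ->.
  by move=> /andP[r0 ru]; split => //; split => //; rewrite in_itv/= r0.
rewrite lebesgue_measure_itv/= lte_fin oppr0 adde0.
by have := f0 u; rewrite le_eqVlt => /orP[/eqP <-|->//]; rewrite ltxx.
Qed.

End directional_mean.

(** * Uniformity over directions *)

Section grid.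
Context {R : realType} {d : nat}.

(** The grid of step [1 / m.+1] of the points whose coordinates lie between -1
and 1; the index [k i] is the coordinate scaled by [m.+1] and shifted to be
nonnegative. *)
Definition grid (m : nat) (k : {ffun 'I_d -> 'I_(2 * m.+1).+1}) : 'rV[R]_d :=
  \row_i ((k i)%:R / m.+1%:R - 1).

Definition width (m : nat) : R := d.+1%:R / m.+1%:R.

Lemma width_gt0 m : 0 < width m.
Proof. by rewrite divr_gt0. Qed.

(** Rounds each coordinate of [v] down to a multiple of [1 / m.+1]; the sum of
the [d] errors is less than [width m], whose numerator is [d.+1]. *)
Lemma grid_approx (m : nat) (v : 'rV[R]_d) : (forall i, `|v 0 i| <= 1) ->
  exists k : {ffun 'I_d -> 'I_(2 * m.+1).+1}, forall u, unit_sphere u ->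
    `|dot v u - dot (grid k) u| < width m.
Proof.
move=> v1; pose N : R := m.+1%:R.
have N0 : 0 < N by rewrite ltr0n.
pose a i := (v 0 i + 1) * N.
have a0 i : 0 <= a i.
  rewrite mulr_ge0 ?(ltW N0)//; have := v1 i; rewrite ler_norml => /andP[? ?]; lra.
have aN i : (Num.truncn (a i) < (2 * m.+1).+1)%N.
  rewrite ltnS -(ler_nat R); apply: (@le_trans _ _ (a i)); first by rewrite truncn_le.
  rewrite natrM -/N ler_wpM2r ?(ltW N0)//.
  by have := v1 i; rewrite ler_norml => /andP[? ?]; lra.
exists [ffun i => Ordinal (aN i)] => u u1.
rewrite -dotNl -dotDl.
apply: (le_lt_trans (dot_sphere_le _ u1)).
apply: (@le_lt_trans _ _ (\sum_(i < d) N^-1)).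
  apply: ler_sum => i _; rewrite !mxE ffunE/= -/N.
  have /andP[ka ak] := truncn_itv (a0 i).
  set k := (Num.truncn (a i))%:R in ka.
  have vE : v 0 i = a i / N - 1 by rewrite /a mulfK ?gt_eqF// addrK.
  have -> : v 0 i + - (k / N - 1) = (a i - k) / N by rewrite vE; ring.
  have Ni : 0 <= N^-1 by rewrite invr_ge0 ltW.
  rewrite normrM (ger0_norm Ni) ler_piMl// ger0_norm ?subr_ge0// lerBlDl.
  by move: ak; rewrite -natr1 -/k => /ltW.
rewrite sumr_const card_ord -mulr_natl /width -/N ltr_pM2r ?invr_gt0//.
by rewrite ltr_nat.
Qed.

End grid.

Section moments.
Context {R : realType}.

Lemma powR_le1D (x p q : R) : 0 <= x -> 0 <= p <= q -> x `^ p <= 1 + x `^ q.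
Proof.
move=> x0 /andP[p0 pq]; have [x1|x1] := leP x 1.
  apply: (@le_trans _ _ 1); last by rewrite lerDl powR_ge0.
  have -> : 1 = 1 `^ p :> R by rewrite powR1.
  by rewrite ge0_ler_powR ?nnegrE.
by rewrite (le_trans (ler_powR (ltW x1) pq))// lerDr.
Qed.

End moments.

Lemma near_finType (T : Type) (F : set_system T) (I : finType)
    (Q : I -> T -> Prop) : Filter F ->
  (forall i, F (Q i)) -> F (fun x => forall i, Q i x).
Proof.
move=> FF FQ.
suff : F (fun x => forall i, i \in enum I -> Q i x).
  by apply: filterS => x Qx i; apply: Qx; rewrite mem_enum.
elim: (enum I) => [|j s IH]; first by apply: filterE.
apply: filterS2 (FQ j) IH => x Qj Qs i; rewrite inE => /orP[/eqP->//|].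
exact: Qs.
Qed.

Section hyperplane_process.
Context {R : realType} {d : nat} {d0 : measure_display} {Omega : measurableType d0}.
Variables (P : probability Omega R) (phi : probability (borel_rV R d) R) (gamma : R).
Variable Y : nat -> {mfun Omega >-> (borel_rV R d * R)%type}.
Hypothesis hY : is_poisson_hyperplane_process P phi gamma Y.
Variable X : nat -> {RV P >-> R}.
Hypothesis X_ge0 : forall i w, 0 <= X i w.
Hypothesis X_indep : mutually_independent P X.
Hypothesis X_ident : identically_distributed P X.
Hypothesis X_Y : independent_sequences P X Y.
Hypothesis X_moment : exists2 eps : R, 0 < eps &
    ('E_P[(fun w => X 0%N w `^ (d%:R + eps))%R] < +oo)%E.

Let phi_sphere : phi (@unit_sphere R d) = 1%E.
Proof. by have [[]] := hY. Qed.

Let gamma_gt0 : 0 < gamma.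
Proof. by have [] := hY. Qed.

Let Y_ge0 i w : 0 <= (Y i w).2.
Proof. by have [_ _ /(_ i w)[]] := hY. Qed.

Let Y_sphere i w : unit_sphere ((Y i w).1 : 'rV[R]_d).
Proof. by have [_ _ /(_ i w)[]] := hY. Qed.

Lemma dim_gt0 : (0 < d)%N.
Proof.
have := Y_sphere 0%N; rewrite unit_sphereE /= => /(_ point).
case: d Y => // Y'; rewrite /dot big_ord0 => /eqP.
by rewrite eq_sym oner_eq0.
Qed.

Definition mean_passage : R := fine ('E_P[X 0%N])%E.

(** The exponent is capped at [e <= 1] as required for the truncation estimate;
[1 + e <= d + eps] holds because the sphere is nonempty, hence [0 < d]. *)
Lemma passage_moments : exists e C : R, [/\ 0 < e <= 1,
  (\int[P]_w (`|X 0%N w|)%:E = mean_passage%:E)%E &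
  (\int[P]_w (`|X 0%N w| `^ (1 + e))%:E = C%:E)%E].
Proof.
have [eps eps0 Xeps] := X_moment.
pose e := Num.min eps 1; exists e.
have e01 : 0 < e <= 1 by rewrite lt_min eps0 ltr01 ge_min lexx orbT.
have /andP[e0 e1] := e01.
have q1 : 1 + e <= d%:R + eps.
  by rewrite lerD ?ler1n ?dim_gt0// ge_min lexx.
have fin p : 0 <= p <= d%:R + eps ->
    (\int[P]_w (`|X 0%N w| `^ p)%:E < +oo)%E.
  move=> pq; have mp (r : R) : measurable_fun setT (fun w => (`|X 0%N w| `^ r)%:E).
    apply/measurable_EFinP.
    apply: (measurableT_comp (measurable_powR r)).
    by apply: measurableT_comp => //; exact: normr_measurable.
  have p0 (r : R) w : (0 <= (`|X 0%N w| `^ r)%:E)%E by rewrite lee_fin powR_ge0.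
  apply: (@le_lt_trans _ _ (\int[P]_w (1 + (`|X 0%N w| `^ (d%:R + eps))%:E))%E).
    apply: ge0_le_integral => //.
    - by apply: emeasurable_funD.
    - by move=> w _; rewrite -EFinD lee_fin powR_le1D.
  rewrite ge0_integralD//; apply: lte_add_pinfty.
    by rewrite integral_cst// mul1e; apply: (le_lt_trans (probability_le1 P _)); rewrite ?ltry.
  move: Xeps; rewrite unlock; congr (_ < _)%E.
  by apply: eq_integral => w _; rewrite /= ger0_norm.
have E1 : (\int[P]_w (`|X 0%N w|)%:E = \int[P]_w (`|X 0%N w| `^ 1)%:E)%E.
  by apply: eq_integral => w _; rewrite powRr1.
exists (fine (\int[P]_w (`|X 0%N w| `^ (1 + e))%:E)%E); split => //.
- have EX : ('E_P[X 0%N] = \int[P]_w (`|X 0%N w|)%:E)%E.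
    by rewrite unlock; apply: eq_integral => w _; rewrite /= ger0_norm.
  rewrite /mean_passage EX fineK// ge0_fin_numE; last by apply: integral_ge0 => w _;
    rewrite lee_fin.
  by rewrite E1; apply: fin; rewrite ler01 (le_trans _ q1)// lerDl ltW.
- rewrite fineK// ge0_fin_numE; last by apply: integral_ge0 => w _; rewrite lee_fin powR_ge0.
  by apply: fin; rewrite q1 andbT addr_ge0// ltW.
Qed.

Lemma mean_passage_ge0 : 0 <= mean_passage.
Proof.
rewrite /mean_passage fine_ge0// unlock; apply: integral_ge0 => w _.
by rewrite lee_fin.
Qed.

Lemma poisson_below (f : borel_rV R d -> R) (k : nat) : bounded_direction f ->
  P [set w | point_count Y (below f) w = (k%:R : R)%:E] =
  poisson_prob (gamma * mean phi f) 0%N [set k].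
Proof.
move=> bf; have [_ _ _ [+ _ _]] := hY.
have [mf _ _] := bf.
move=> /(_ _ (measurable_below mf)); rewrite (intensity_below phi_sphere)//.
by move=> /(_ (ltry _) k).
Qed.

Lemma slln_below (f : borel_rV R d -> R) : bounded_direction f ->
  {ae P, forall w, forall delta : R, 0 < delta ->
  \forall t \near +oo,
    (((mean_passage * (gamma * mean phi f) - delta) * t)%:E <=
       marked_sum X Y Num.norm (below (fun u => (t * f u)%R)) w <=
     ((mean_passage * (gamma * mean phi f) + delta) * t)%:E)%E}.
Proof.
move=> bf; have [e [C [e01 Em EC]]] := passage_moments.
have [mf f0 _] := bf.
apply: (@marked_sum_slln _ _ _ _ _ P X Y X_indep X_ident X_Y
  (fun t => below (fun u => t * f u)) _ _ _ _ _ e C) => //.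
- by move=> t t0; apply: measurable_below; exact: measurable_funM.
- move=> s t s0 st q; rewrite /below/= => /le_trans; apply.
  by rewrite ler_wpM2r.
- by rewrite mulr_ge0 ?(ltW gamma_gt0)// (mean_ge0 phi_sphere).
- move=> t t0 k; rewrite poisson_below ?(meanZ phi_sphere) ?(ltW t0)//.
    by rewrite mulrCA.
  by apply: bounded_directionZ => //; exact: ltW.
Qed.

Lemma expected_hitting_number (x : 'rV[R]_d) :
  (\int[P]_w hitting_number (fun i => hyperplane (Y i w)) x =
   (gamma * mean phi (pos_dot x))%:E)%E.
Proof.
have bx := bounded_pos_dot x.
have E w : hitting_number (fun i => hyperplane (Y i w)) x =
    point_count Y (below (pos_dot x)) w by rewrite hitting_numberE.
under eq_integral do rewrite E.
apply: poisson_mean.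
- by rewrite mulr_ge0 ?(ltW gamma_gt0)// (mean_ge0 phi_sphere).
- by apply: measurable_point_count; apply: measurable_below; exact: measurable_pos_dot.
- by move=> w; exact: point_count_ge0.
- by move=> k; exact: poisson_below.
Qed.

(** The limit of [tau(0, t x) / t] as [t] tends to infinity. *)
Definition speed (x : 'rV[R]_d) : R :=
  mean_passage * (gamma * mean phi (pos_dot x)).

Definition upper_bracket m (k : {ffun 'I_d -> 'I_(2 * m.+1).+1}) (u : borel_rV R d) : R :=
  Num.max 0 (dot (grid k) u + @width R d m).

Definition lower_bracket m (k : {ffun 'I_d -> 'I_(2 * m.+1).+1}) (u : borel_rV R d) : R :=
  Num.max 0 (dot (grid k) u - @width R d m).

Arguments upper_bracket : clear implicits.
Arguments lower_bracket : clear implicits.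

Definition bracket_control (w : Omega) : Prop :=
  forall m (k : {ffun 'I_d -> 'I_(2 * m.+1).+1}) (delta : R), 0 < delta ->
  \forall t \near +oo,
    (((mean_passage * (gamma * mean phi (lower_bracket m k)) - delta) * t)%:E <=
       marked_sum X Y Num.norm (below (fun u => t * lower_bracket m k u)%R) w)%E /\
    (marked_sum X Y Num.norm (below (fun u => t * upper_bracket m k u)%R) w <=
     ((mean_passage * (gamma * mean phi (upper_bracket m k)) + delta) * t)%:E)%E.

(** There are countably many brackets, so the exceptional null sets can be
united. *)
Lemma bracket_control_ae : {ae P, forall w, bracket_control w}.
Proof.
apply: ae_foralln => m; apply: near_finType => k.
have bu : bounded_direction (upper_bracket m k) by exact: bounded_bracket.
have bl : bounded_direction (lower_bracket m k) by exact: bounded_bracket.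
apply: filterS2 (slln_below bu) (slln_below bl) => w hu hl delta delta0.
by apply: filterS2 (hu _ delta0) (hl _ delta0) => t /andP[_ ?] /andP[? _].
Qed.

Let tau w := passage_time (fun i => hyperplane (Y i w)) (fun i => X i w).

(** Write [x = s v] with [v] on the sphere and [y] the grid point close to [v].
The means of the two brackets at [y] differ from the mean of [pos_dot v] by at
most [2 * width m]; choosing [m] with [2 * A * width m <= delta / 2] leaves half
of [delta] for the finitely many laws of large numbers. *)
Lemma uniform_estimate w : bracket_control w -> forall delta : R, 0 < delta ->
  exists2 M : R, 0 < M & forall x : 'rV[R]_d, M < enorm x ->
    ((speed x - delta * enorm x)%:E <= tau w 0 x <= (speed x + delta * enorm x)%:E)%E.
Proof.
move=> good delta delta0.
pose A := mean_passage * gamma.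
have A0 : 0 <= A by rewrite mulr_ge0 ?mean_passage_ge0// ltW.
pose m := Num.truncn (4 * A * d.+1%:R / delta).
have Aw : 2 * A * @width R d m <= delta / 2.
  have := truncnS_gt (4 * A * d.+1%:R / delta); rewrite -/m.
  rewrite ltr_pdivrMr// => h.
  rewrite /width mulrA ler_pdivrMr//.
  by move: h; set N := m.+1%:R; set D := d.+1%:R; move=> h; lra.
have d20 : 0 < delta / 2 by rewrite divr_gt0.
have [M0 [_ HM0]] := near_finType (Q := fun k t => _) _ (fun k => good m k _ d20).
exists (Num.max M0 1); first by rewrite lt_max ltr01 orbT.
move=> x; rewrite gt_max => /andP[M0x x1].
set s := enorm x in M0x x1 *.
have s0 : 0 < s by apply: lt_trans x1.
have xn0 : x != 0.
  apply: contraTneq s0 => x0.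
  by rewrite /s x0 /enorm dot0l sqrtr0 ltxx.
pose v := s^-1 *: x.
have dotx u : dot x u = s * dot v u.
  by rewrite -dotZl scalerA divff ?gt_eqF// scale1r.
have v1 i : `|v 0 i| <= 1.
  apply: (le_trans (enorm_coord _ _)); rewrite enormZ ger0_norm ?invr_ge0 ?(ltW s0)//.
  by rewrite -/s mulVf// gt_eqF.
have xv : x = s *: v by rewrite scalerA divff ?gt_eqF// scale1r.
have [k yk] := grid_approx m v1.
set y := grid k in yk; set c := @width R d m in yk Aw.
have c0 : 0 < c by exact: width_gt0.
have [lo up] := HM0 s M0x k.
have bu : bounded_direction (upper_bracket m k) by exact: bounded_bracket.
have bl : bounded_direction (lower_bracket m k) by exact: bounded_bracket.
have bc : bounded_direction (cst (2 * c) : borel_rV R d -> R).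
  by apply: bounded_cst; rewrite mulr_ge0// ltW.
have bv := bounded_pos_dot v.
have c20 : 0 <= 2 * c by rewrite mulr_ge0// ltW.
have mu : mean phi (upper_bracket m k) <= mean phi (pos_dot v) + 2 * c.
  rewrite -[X in _ + X](mean_cst phi_sphere c20).
  apply: (mean_le_add phi_sphere) => // u u1.
  have := yk u u1; rewrite ltr_norml /upper_bracket /pos_dot /= -/y -/c => /andP[h1 h2].
  have h3 : dot v u <= Num.max 0 (dot v u) by rewrite le_max lexx orbT.
  have h4 : 0 <= Num.max 0 (dot v u) by rewrite le_max lexx.
  by rewrite ge_max; apply/andP; split; lra.
have ml : mean phi (pos_dot v) <= mean phi (lower_bracket m k) + 2 * c.
  rewrite -[X in _ + X](mean_cst phi_sphere c20).
  apply: (mean_le_add phi_sphere) => // u u1.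
  have := yk u u1; rewrite ltr_norml /lower_bracket /pos_dot /= -/y -/c => /andP[h1 h2].
  have h3 : dot y u - c <= Num.max 0 (dot y u - c) by rewrite le_max lexx orbT.
  have h4 : 0 <= Num.max 0 (dot y u - c) by rewrite le_max lexx.
  by rewrite ge_max; apply/andP; split; lra.
have spx : speed x = s * (A * mean phi (pos_dot v)).
  by rewrite /speed xv (mean_pos_dotZ phi_sphere) ?(ltW s0)// /A; ring.
rewrite /tau passage_timeE//.
apply/andP; split.
  apply: (@le_trans _ _ ((mean_passage * (gamma * mean phi (lower_bracket m k)) - delta / 2) *
    s)%:E).
    rewrite lee_fin spx.
    have h : A * mean phi (pos_dot v) <= A * (mean phi (lower_bracket m k) + 2 * c).
      by rewrite ler_wpM2l.
    have h' : A * mean phi (pos_dot v) - delta <= A * mean phi (lower_bracket m k) - delta / 2.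
      by lra.
    have := ler_wpM2r (ltW s0) h'.
    by rewrite /A; lra.
  apply: (le_trans lo); apply: separates_sum_ge => // i.
  rewrite /below/= /lower_bracket /separates -/y -/c => pi_le.
  have := Y_ge0 i w; rewrite le_eqVlt eq_sym => /orP[->//|p0].
  apply/orP; right.
  have := yk _ (Y_sphere i w); rewrite ltr_norml => /andP[h1 h2].
  have [h|h] := leP (dot y (Y i w).1 - c) 0.
    by move: pi_le; rewrite (max_l h) mulr0 leNgt p0.
  move: pi_le; rewrite (max_r (ltW h)) => /le_lt_trans; apply.
  by rewrite dotx ltr_pM2l//; lra.
apply: (@le_trans _ _ ((mean_passage * (gamma * mean phi (upper_bracket m k)) + delta / 2) *
  s)%:E); last first.
  rewrite lee_fin spx.
  have h : A * mean phi (upper_bracket m k) <= A * (mean phi (pos_dot v) + 2 * c).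
    by rewrite ler_wpM2l.
  have h' : A * mean phi (upper_bracket m k) + delta / 2 <= A * mean phi (pos_dot v) + delta.
    by lra.
  have := ler_wpM2r (ltW s0) h'.
  by rewrite /A; lra.
apply: le_trans up; apply: separates_sum_le => // i.
rewrite /below/= /upper_bracket /separates -/y -/c => /orP[/eqP ->|pi_lt].
  by rewrite mulr_ge0 ?(ltW s0)// le_max lexx.
have := yk _ (Y_sphere i w); rewrite ltr_norml => /andP[h1 h2].
apply: (le_trans (ltW pi_lt)); rewrite dotx ler_pM2l//.
by rewrite le_max; apply/orP; right; lra.
Qed.

End hyperplane_process.

(** * Norm properties of the speed *)

Section mean_width.
Context {R : realType} {d : nat}.
Variable phi : probability (borel_rV R d) R.
Hypothesis phi_dir : is_directional_distribution phi.
Local Notation T := (borel_rV R d).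
Local Notation sphere := (@unit_sphere R d : set T).

Let phi_sphere : phi (@unit_sphere R d) = 1%E.
Proof. by have [] := phi_dir. Qed.

Let opp (u : T) : T := - (u : 'rV[R]_d).

Lemma measurable_opp_rV : measurable_fun setT opp.
Proof.
apply: (@measurability _ _ T T setT _ (@open 'rV[R]_d)) => //.
move=> _ [A oA <-]; rewrite setTI; apply: sub_sigma_algebra.
by apply: open_comp => // u _; exact: opp_continuous.
Qed.

Lemma mean_even (f : T -> R) : measurable_fun setT f -> (forall u, 0 <= f u) ->
  mean phi (fun u => f (- (u : 'rV[R]_d))) = mean phi f.
Proof.
move=> mf f0; rewrite /mean; congr fine.
have [_ phi_even _] := phi_dir.
pose oppM : {mfun T >-> T} :=
  HB.pack opp (isMeasurableFun.Build _ _ _ _ _ measurable_opp_rV).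
transitivity (\int[distribution phi oppM]_u (f u)%:E)%E.
  rewrite ge0_integral_distribution//.
    exact/measurable_EFinP.
by apply: eq_measure_integral => A mA _; exact: phi_even.
Qed.

Lemma mean_pos_dotN (x : 'rV[R]_d) : mean phi (pos_dot (- x)) = mean phi (pos_dot x).
Proof.
rewrite -(@mean_even (pos_dot x)); last 2 first.
- exact: measurable_pos_dot.
- by move=> u; rewrite le_max lexx.
congr (mean phi _); apply/funext => u.
by rewrite /pos_dot dotNl [dot x (- _)]dotC dotNl dotC.
Qed.

Lemma mean_pos_dot_seminorm : is_seminorm (fun x => mean phi (pos_dot x)).
Proof.
have mean0 x : 0 <= mean phi (pos_dot x).
  by apply: (mean_ge0 phi_sphere); exact: bounded_pos_dot.
have meanZ a x : 0 <= a -> mean phi (pos_dot (a *: x)) = a * mean phi (pos_dot x).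
  exact: (mean_pos_dotZ phi_sphere).
split => //.
- move=> a x; have [a0|a0] := leP 0 a; first by rewrite meanZ// ger0_norm.
  by rewrite -mean_pos_dotN -scaleNr meanZ ?oppr_ge0 ?(ltW a0)// ltr0_norm.
- move=> x y; apply: (mean_le_add phi_sphere); try exact: bounded_pos_dot.
  move=> u _; rewrite /pos_dot dotDl.
  have h1 : dot x u <= Num.max 0 (dot x u) by rewrite le_max lexx orbT.
  have h2 : 0 <= Num.max 0 (dot x u) by rewrite le_max lexx.
  have h3 : dot y u <= Num.max 0 (dot y u) by rewrite le_max lexx orbT.
  have h4 : 0 <= Num.max 0 (dot y u) by rewrite le_max lexx.
  by rewrite ge_max; apply/andP; split; lra.
Qed.

Lemma mean_pos_dot_le (x : 'rV[R]_d) : mean phi (pos_dot x) <= \sum_(i < d) `|x 0 i|.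
Proof.
set K := \sum_(i < d) _; have K0 : 0 <= K by apply: sumr_ge0.
have z0 : 0 <= 0 :> R by [].
have : mean phi (pos_dot x) <= mean phi (cst K) + mean phi (cst 0).
  apply: (mean_le_add phi_sphere);
    [exact: bounded_pos_dot|exact: bounded_cst|exact: bounded_cst|].
  move=> u u1; rewrite /= addr0 ge_max K0/=.
  by rewrite (le_trans (ler_norm _))//; exact: dot_sphere_le.
by rewrite !(mean_cst phi_sphere)// addr0.
Qed.

(** By evenness both max(0, <x,u>) and max(0, - <x,u>) have mean 0, so <x,u>
vanishes for almost all [u], which for [x != 0] puts the directional
distribution on a great subsphere. *)
Lemma mean_pos_dot_eq0 (x : 'rV[R]_d) : mean phi (pos_dot x) = 0 -> x = 0.
Proof.
move=> mx; apply/eqP/negPn/negP => x0.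
have s0 : 0 < enorm x by exact: enorm_gt0.
have mdot : measurable_fun setT (fun u : T => (dot x u)%:E).
  by apply/measurable_EFinP; exact: measurable_dotr.
have abs0 : (\int[phi]_u `|(dot x u)%:E| = 0)%E.
  transitivity (\int[phi]_u ((pos_dot x u)%:E + (pos_dot (- x) u)%:E))%E.
    apply: eq_integral => u _; rewrite -EFinD /=; congr EFin.
    rewrite /pos_dot dotNl; have [h|h] := leP 0 (dot x u).
      by rewrite ger0_norm// max_l ?addr0// oppr_le0.
    by rewrite ltr0_norm// max_r ?add0r// oppr_ge0 ltW.
  have pd0 y (u : T) : (0 <= (pos_dot y u)%:E)%E by rewrite lee_fin le_max lexx.
  have mpd y : measurable_fun setT (fun u : T => (pos_dot y u)%:E).
    by apply/measurable_EFinP; exact: measurable_pos_dot.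
  rewrite ge0_integralD// !(integral_mean phi_sphere); try exact: bounded_pos_dot.
  by rewrite mean_pos_dotN mx adde0.
have dot0_ae : {ae phi, forall u : T, dot x (u : 'rV[R]_d) = 0}.
  have /(_ abs0) := (ae_eq_integral_abs phi measurableT mdot).1.
  by apply: filterS => u /(_ I) [].
have sphere_ae : {ae phi, forall u : T, sphere u}.
  apply/negligibleP; first exact: measurableC (@measurable_unit_sphere R d).
  have PT := probability_setC phi (@measurable_unit_sphere R d).
  by transitivity (1 - phi sphere)%E; [exact: PT|rewrite phi_sphere subee].
pose v := (enorm x)^-1 *: x.
have v1 : unit_sphere v.
  by rewrite /unit_sphere/= enormZ ger0_norm ?invr_ge0 ?(ltW s0)// mulVf// gt_eqF.
have [_ _ /(_ v v1)] := phi_dir.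
pose Z : set T := [set u : 'rV[R]_d | unit_sphere u /\ dot u v = 0].
have mZ : measurable Z.
  apply: measurableI; first exact: measurable_unit_sphere.
  have := measurable_dotr v measurableT (measurable_set1 (0 : R)).
  rewrite setTI; congr (measurable _); apply/seteqP.
  by split => u /=; rewrite dotC.
have Z_ae : {ae phi, forall u : T, Z u}.
  have FF := ae_filter_ringOfSetsType phi.
  apply: filterS2 sphere_ae dot0_ae => u u1 xu; split => //.
  by rewrite dotC dotZl xu mulr0.
have Z0 : phi (~` Z) = 0%E by apply/negligibleP => //; exact: measurableC.
have := probability_setC phi (measurableC mZ).
rewrite setCK => PZ.
suff -> : phi Z = 1%E by rewrite ltxx.
by transitivity (1 - phi (~` Z))%E; [exact: PZ|rewrite Z0 sube0].
Qed.

(** A seminorm bounded by the sum of the absolute values of the coordinates is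
Lipschitz for that norm. *)
Lemma continuous_mean_pos_dot : continuous (fun x : 'rV[R]_d => mean phi (pos_dot x)).
Proof.
have [_ mZ mD] := mean_pos_dot_seminorm.
have lip x y : mean phi (pos_dot x) - mean phi (pos_dot y) <= \sum_(i < d) `|x 0 i - y 0 i|.
  rewrite lerBlDl; apply: (le_trans _ (lerD (lexx _) _)); last first.
    apply: (le_trans (mean_pos_dot_le (x - y))).
    by apply: ler_sum => i _; rewrite !mxE.
  by rewrite -[X in pos_dot X](subrK y) addrC mD.
move=> x; apply/(@cvgrPdist_le _ _ _ _ (nbhs_filter x)) => e e0.
have cont : continuous (fun y : 'rV[R]_d => \sum_(i < d) `|x 0 i - y 0 i|).
  apply: continuous_big => [|i _]; first exact: add_continuous.
  move=> y; apply: (@continuous_comp _ _ _ (fun y : 'rV[R]_d => x 0 i - y 0 i)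
    (Num.norm : R -> R)); last exact: norm_continuous.
  apply: cvgB; [exact: nbhs_filter| |exact: (@coord_continuous R)].
  by apply: cvg_cst; exact: nbhs_filter.
have := cont x; rewrite /continuous_at big1; last by move=> i _; rewrite subrr normr0.
move=> /cvgr_le /(_ _ e0); apply: filterS => y ye.
rewrite ler_norml lerNl opprB; apply/andP; split.
  apply: (le_trans (lip _ _)); apply: le_trans ye; apply: ler_sum => i _.
  by rewrite distrC.
exact: le_trans (lip _ _) ye.
Qed.

(** The minimum of the continuous positive function over the compact sphere. *)
Lemma mean_pos_dot_lower : exists2 c : R, 0 < c &
  forall x : 'rV[R]_d, c * enorm x <= mean phi (pos_dot x).
Proof.
have nonempty : @unit_sphere R d !=set0.
  apply/set0P/eqP => S0; move: phi_sphere; rewrite S0 measure0 => /eqP.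
  by rewrite eqe eq_sym oner_eq0.
have cont : {within @unit_sphere R d, continuous (fun x => mean phi (pos_dot x))}.
  by apply: continuous_subspaceT; exact: continuous_mean_pos_dot.
have [c cS cmin] := EVT_min_rV nonempty (@compact_unit_sphere R d) cont.
have [mean0 mZ _] := mean_pos_dot_seminorm.
have c1 : unit_sphere c by rewrite -[unit_sphere c]inE.
exists (mean phi (pos_dot c)).
  rewrite lt_neqAle mean0 andbT eq_sym; apply/eqP => /mean_pos_dot_eq0 c0.
  by move: c1; rewrite c0 /unit_sphere/= /enorm dot0l sqrtr0 => /eqP; rewrite eq_sym oner_eq0.
move=> x; have [->|x0] := eqVneq x 0; first by rewrite /enorm dot0l sqrtr0 mulr0.
have s0 := enorm_gt0 x0.
have -> : x = enorm x *: ((enorm x)^-1 *: x) by rewrite scalerA divff ?gt_eqF// scale1r.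
rewrite mZ enormZ ger0_norm ?(ltW s0)// enormZ ger0_norm ?invr_ge0 ?(ltW s0)//.
rewrite mulVf ?gt_eqF// mulr1 mulrC ler_pM2l// cmin// inE /unit_sphere/= enormZ.
by rewrite ger0_norm ?invr_ge0 ?(ltW s0)// mulVf// gt_eqF.
Qed.

End mean_width.

(** * From the uniform estimate to the shape theorems *)

Section deterministic_shape.
Context {R : realType} {d : nat}.
Variables (p : nat -> borel_rV R d * R) (X : nat -> R) (mu : 'rV[R]_d -> R).
Hypothesis p_ge0 : forall i, 0 <= (p i).2.
Hypothesis X_ge0 : forall i, 0 <= X i.
Hypothesis mu_semi : is_seminorm mu.
Let tau := passage_time (fun i => hyperplane (p i)) X.
Hypothesis tau_mu : forall delta : R, 0 < delta ->
  exists2 M : R, 0 < M & forall x : 'rV[R]_d, M < enorm x ->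
    ((mu x - delta * enorm x)%:E <= tau 0 x <= (mu x + delta * enorm x)%:E)%E.

Lemma enorm_pinfty_filter : Filter (@enorm_pinfty R d).
Proof.
apply: filter_from_filter; first by exists 0.
move=> i j _ _; exists (Num.max i j) => // x /=.
by rewrite gt_max => /andP[].
Qed.

Lemma weak_shape_cvg :
  (fun x : 'rV[R]_d => (((enorm x)^-1)%:E * (tau 0%R x - (mu x)%:E))%E)
      @ (@enorm_pinfty R d) --> (0 : \bar R)%E.
Proof.
have FF := enorm_pinfty_filter.
have bound (e : R) : 0 < e -> \forall x \near @enorm_pinfty R d,
   tau 0 x \is a fin_num /\
   `|0 - fine (((enorm x)^-1)%:E * (tau 0%R x - (mu x)%:E))%E| <= e.
  move=> e0; have [M M0 HM] := tau_mu e0.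
  exists M => // x /= Mx; have /andP[lo up] := HM x Mx.
  have s0 : 0 < enorm x by exact: lt_trans Mx.
  move: lo up; case: (tau 0 x) => [t| |]//; rewrite !lee_fin => lo up.
  split => //; rewrite /= sub0r normrN normrM ger0_norm ?invr_ge0 ?(ltW s0)//.
  rewrite ler_pdivrMl// ler_norml mulrC; apply/andP; split; lra.
apply/fine_cvgP; split.
  apply: filterS (bound 1 ltr01) => x [tfin _].
  by rewrite fin_numM// fin_numB tfin.
apply/cvgrPdist_le => e e0.
by apply: filterS (bound e e0) => x [].
Qed.

Variables c C : R.
Hypothesis c_gt0 : 0 < c.
Hypothesis C_ge0 : 0 <= C.
Hypothesis mu_lower : forall x, c * enorm x <= mu x.
Hypothesis mu_upper : forall x, mu x <= C * enorm x.

(** The asymptotic estimate says nothing near the origin; there, the passage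
time is compared with that of the point at a large distance [r] on the same
ray. *)
Lemma bounded_on_balls (M : R) : exists2 K : R, 0 < K & forall x, enorm x <= M ->
    mu x <= K /\ (tau 0 x <= K%:E)%E.
Proof.
have [N N0 HN] := tau_mu ltr01.
(* [r] exceeds [M], so that rays reach it from the ball, and [N], so that the
   asymptotic estimate applies there. *)
pose r := Num.max M N + 1.
have Mr : M < r by rewrite ltr_pwDr// le_max lexx.
have Nr : N < r by rewrite ltr_pwDr// le_max lexx orbT.
have r0 : 0 < r by exact: lt_trans Nr.
exists (C * r + r); first by rewrite ltr_wpDl// mulr_ge0// ltW.
move=> x xM; have xr : enorm x <= r by rewrite (le_trans xM)// ltW.
split.
  apply: (le_trans (mu_upper x)); rewrite ler_wpDr ?(ltW r0)//.
  by rewrite ler_wpM2l.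
have [->|x0] := eqVneq x 0.
  by rewrite /tau passage_time_diag// lee_fin addr_ge0 ?mulr_ge0 ?(ltW r0).
have s0 := enorm_gt0 x0.
have a1 : 1 <= r / enorm x by rewrite ler_pdivlMr// mul1r.
apply: (le_trans (passage_time_ray p_ge0 X_ge0 x a1)).
set y := _ *: x.
have yr : enorm y = r.
  rewrite /y enormZ ger0_norm; last by rewrite (le_trans ler01).
  by rewrite divfK// gt_eqF.
have Ny : N < enorm y by rewrite yr.
have /andP[_ up] := HN y Ny.
apply: (le_trans up); rewrite lee_fin mul1r yr lerD2r -yr; exact: mu_upper.
Qed.

(** As [c * enorm x <= mu x], the asymptotic error at rate [eta] costs at most
the fraction [eps / (1 + eps)] of [mu]; the inverse of
[1 - eps / (1 + eps)] is [1 + eps]. *)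
Lemma shape_inclusions (eps : R) : 0 < eps ->
  \forall n \near \oo,
   let B := dilate (n%:R)^-1 [set y | (tau 0 y <= n%:R%:E)%E] in
        (eps < 1 -> dilate (1 - eps) [set x | mu x <= 1] `<=` B) /\
        B `<=` dilate (1 + eps) [set x | mu x <= 1].
Proof.
move=> eps0; have [mu0 muZ muD] := mu_semi.
pose eta := c * (eps / (1 + eps)).
have e1 : 0 < 1 + eps by rewrite addr_gt0.
have eta0 : 0 < eta by rewrite mulr_gt0// divr_gt0.
have [M M0 HM] := tau_mu eta0.
have eta_mu x : eta * enorm x <= eps / (1 + eps) * mu x.
  by rewrite /eta mulrAC mulrC ler_wpM2l// divr_ge0// ltW.
have [muM muM0 HmuM] := bounded_on_balls M.
near=> n.
have n0 : 0 < n%:R :> R by rewrite ltr0n; near: n; exact: nbhs_infty_gt.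
have Kn : muM <= n%:R by near: n; exact: nbhs_infty_ger.
split.
  move=> eps1 _ [x /= x1 <-].
  exists (n%:R *: ((1 - eps) *: x)); last by rewrite [LHS]scalerA mulVf ?gt_eqF// scale1r.
  rewrite /=; set y := n%:R *: _.
  have muy : mu y <= n%:R * (1 - eps).
    rewrite /y !muZ (ger0_norm (ltW n0)) ger0_norm; last by lra.
    by rewrite mulrA ler_piMr// mulr_ge0 ?(ltW n0)//; lra.
  have [yM|yM] := leP (enorm y) M.
    by have [_ h] := HmuM y yM; apply: (le_trans h); rewrite lee_fin.
  have /andP[_ up] := HM y yM; apply: (le_trans up); rewrite lee_fin.
  apply: (le_trans (lerD (lexx _) (eta_mu y))).
  have h : eps / (1 + eps) <= eps by rewrite ler_pdivrMr// ler_peMr ?(ltW eps0)//; lra.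
  have h2 : eps / (1 + eps) * mu y <= eps * mu y by rewrite ler_wpM2r.
  have h3 : (1 + eps) * mu y <= (1 + eps) * (n%:R * (1 - eps)) by rewrite ler_wpM2l// ltW.
  have h4 : 0 <= eps * eps * n%:R by rewrite !mulr_ge0 ?(ltW n0) ?(ltW eps0).
  by move: h3 h4; set N := n%:R; move=> h3 h4; lra.
move=> _ [y /= ty <-].
have muy : mu y <= (1 + eps) * n%:R.
  have [yM|yM] := leP (enorm y) M.
    have [h _] := HmuM y yM; apply: (le_trans h); apply: (le_trans Kn).
    by rewrite ler_peMl ?(ltW n0)//; lra.
  have /andP[lo _] := HM y yM.
  have := le_trans lo ty; rewrite lee_fin => h.
  have h1 : mu y - eps / (1 + eps) * mu y <= n%:R.
    by apply: le_trans h; rewrite lerD2l lerN2.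
  have -> : mu y = (1 + eps) * (mu y - eps / (1 + eps) * mu y).
    by field; rewrite gt_eqF.
  by rewrite ler_wpM2l// ltW.
exists ((1 + eps)^-1 *: (n%:R^-1 *: y)).
  rewrite /= !muZ !ger0_norm ?invr_ge0 ?(ltW n0) ?(ltW e1)//.
  by rewrite ler_pdivrMl// ler_pdivrMl// mulr1 mulrC.
by rewrite [LHS]scalerA divff ?gt_eqF// scale1r.
Unshelve. all: by end_near. Qed.

End deterministic_shape.

Theorem mainTheorem6 (R : realType) (d : nat)
  (d0 : measure_display) (Omega : measurableType d0) (P : probability Omega R)
  (phi : probability (borel_rV R d) R) (gamma : R)
  (Y : nat -> {mfun Omega >-> (borel_rV R d * R)%type})
  (hY : is_poisson_hyperplane_process P phi gamma Y)
  (X : nat -> {RV P >-> R})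
  (X_ge0 : forall i w, 0 <= X i w)
  (X_indep : mutually_independent P X)
  (X_ident : identically_distributed P X)
  (X_Y : independent_sequences P X Y)
  (X_moment : exists2 eps : R, 0 < eps &
    ('E_P[(fun w => X 0%N w `^ (d%:R + eps))%R] < +oo)%E) :
  let h := zonoid_support P Y in
  let tau w := passage_time (fun i => hyperplane (Y i w)) (fun i => X i w) in
  let mu x := 2 * fine ('E_P[X 0%N])%E * h x in
  weak_shape_theorem P tau mu /\
  ((0 < 'E_P[X 0%N])%E -> shape_theorem P tau [set x | mu x <= 1]).
Proof.
move=> h tau mu.
have [phi_dir gamma_gt0 Y_carrier _] := hY.
have Y_ge0 w i : 0 <= (Y i w).2 by have [] := Y_carrier i w.
have muE : mu = speed phi gamma X.
  apply/funext => x; rewrite /mu /h /zonoid_support (expected_hitting_number hY) /speed.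
  by rewrite -/(mean_passage X) /=; field.
have m0 : 0 <= mean_passage X := mean_passage_ge0 X_ge0.
have [mean0 meanZ meanD] := mean_pos_dot_seminorm phi_dir.
have A0 : 0 <= mean_passage X * gamma by rewrite mulr_ge0// ltW.
have speedE x : mu x = mean_passage X * gamma * mean phi (pos_dot x).
  by rewrite muE /speed mulrA.
have mu_semi : is_seminorm mu.
  split => [x|a x|x y]; rewrite !speedE.
  - by rewrite mulr_ge0.
  - by rewrite meanZ mulrCA.
  - by rewrite -mulrDr ler_wpM2l.
have estimate : {ae P, forall w, forall delta : R, 0 < delta ->
    exists2 M : R, 0 < M & forall x : 'rV[R]_d, M < enorm x ->
    ((mu x - delta * enorm x)%:E <= tau w 0%R x <= (mu x + delta * enorm x)%:E)%E}.
  apply: filterS (bracket_control_ae hY X_ge0 X_indep X_ident X_Y X_moment) => w good.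
  by rewrite muE; exact: (uniform_estimate hY X_ge0 good).
split.
  split; first exact: mu_semi.
  by apply: filterS estimate => w; exact: weak_shape_cvg.
move=> EX0; exists mu.
have m_gt0 : 0 < mean_passage X.
  rewrite /mean_passage fine_gt0// EX0/=.
  have [e [C [_ Em _]]] := passage_moments hY X_ge0 X_moment.
  have -> : ('E_P[X 0%N] = \int[P]_w (`|X 0%N w|)%:E)%E.
    by rewrite unlock; apply: eq_integral => w _; rewrite /= ger0_norm.
  by rewrite Em ltry.
have A_gt0 : 0 < mean_passage X * gamma by rewrite mulr_gt0.
have [c c0 mean_lower] := mean_pos_dot_lower phi_dir.
split => //.
  split => // x /eqP; rewrite speedE mulf_eq0 gt_eqF//= => /eqP.
  exact: mean_pos_dot_eq0.
apply: filterS estimate => w est eps eps0.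
apply: (@shape_inclusions _ _ (fun i => Y i w) (fun i => X i w) mu _ _ mu_semi est
   (mean_passage X * gamma * c) (mean_passage X * gamma * d%:R)) => //.
- by rewrite mulr_gt0.
- by rewrite mulr_ge0.
- by move=> x; rewrite speedE -[leLHS]mulrA ler_pM2l.
- move=> x; rewrite speedE -[leRHS]mulrA ler_pM2l//.
  apply: (le_trans (mean_pos_dot_le phi_dir x)).
  apply: (@le_trans _ _ (\sum_(i < d) enorm x)).
    by apply: ler_sum => i _; exact: enorm_coord.
  by rewrite sumr_const card_ord mulr_natl.
Qed.
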